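(* Let $F$ be a graph with chromatic number 3 that has a color-critical edge, and let $a,b\ge 2$ be integers. Then for all sufficiently large $n$ we have $\mathrm{ex}(n,K_{a,b},F)=\mathrm{ex}(n,K_{a,b},K_3)=\mathcal{N}(K_{a,b},K_{t,n-t})$ for some integer $t$.
   Context: All graphs are finite and simple. A copy of $H$ in $G$ is a (not necessarily induced) subgraph of $G$ isomorphic to $H$; $\mathcal{N}(H,G)$ is the number of copies of $H$ in $G$. $\mathrm{ex}(n,H,F)$ is the maximum of $\mathcal{N}(H,G)$ over all $n$-vertex graphs $G$ containing no copy of $F$. An edge of a graph is color-critical if deleting it yields a graph of smaller chromatic number. $K_{t,n-t}$ is the complete bipartite graph with parts of sizes $t$ and $n-t$. *)

(* Defs.v *)
From HB Require Import structures.
From mathcomp Require Import all_boot.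

Set Implicit Arguments.
Unset Strict Implicit.
Unset Printing Implicit Defensive.

(* A finite simple graph on the vertex type T is given by its edge set, a set
   of two-element subsets of T.  As a subtype of {set {set T}} it is again a
   finType, so that one can maximise over all graphs on T. *)
Record sgraph (T : finType) : Type := SGraph {
  edges : {set {set T}};
  edges_card2 : [forall e in edges, #|e| == 2]
}.

HB.instance Definition _ (T : finType) := [isSub for @edges T].
HB.instance Definition _ (T : finType) := [Finite of sgraph T by <:].

Definition adj (T : finType) (G : sgraph T) : rel T :=
  fun x y => [set x; y] \in edges G.

Definition rel_edges (T : finType) (r : rel T) : {set {set T}} :=
  [set [set x; y] | x in T, y in T & (x != y) && r x y].

Lemma rel_edges_card2 (T : finType) (r : rel T) :
  [forall e in rel_edges r, #|e| == 2].
Proof.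
apply/forall_inP => e /imset2P[x y _]; rewrite inE => /and3P[_ xy _] ->.
by rewrite cards2 xy.
Qed.

Definition graph_of_rel (T : finType) (r : rel T) : sgraph T :=
  SGraph (rel_edges_card2 r).

Definition complete_graph (n : nat) : sgraph 'I_n :=
  graph_of_rel (fun _ _ => true).

Definition complete_bipartite (a b : nat) : sgraph ('I_a + 'I_b)%type :=
  graph_of_rel (fun x y =>
    match x, y with inl _, inr _ => true | _, _ => false end).

Lemma del_edge_card2 (T : finType) (G : sgraph T) (e : {set T}) :
  [forall f in edges G :\ e, #|f| == 2].
Proof.
apply/forall_inP => f /setD1P[_ fG].
exact: (forall_inP (edges_card2 G)).
Qed.

Definition del_edge (T : finType) (G : sgraph T) (e : {set T}) : sgraph T :=
  SGraph (del_edge_card2 G e).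

Definition colorable (T : finType) (G : sgraph T) (k : nat) : bool :=
  [exists c : {ffun T -> 'I_k},
    [forall x, forall y, adj G x y ==> (c x != c y)]].

Lemma adj_neq (T : finType) (G : sgraph T) (x y : T) : adj G x y -> x != y.
Proof.
by move=> /(forall_inP (edges_card2 G)); rewrite cards2; case: (x != y).
Qed.

Lemma ex_colorable (T : finType) (G : sgraph T) : exists k, colorable G k.
Proof.
exists #|T|; apply/existsP; exists [ffun x => enum_rank x].
apply/forallP => x; apply/forallP => y; apply/implyP => /adj_neq xy.
by rewrite !ffunE (inj_eq enum_rank_inj).
Qed.

Definition chromatic_number (T : finType) (G : sgraph T) : nat :=
  ex_minn (ex_colorable G).

Definition color_critical (T : finType) (G : sgraph T) (e : {set T}) : bool :=
  (e \in edges G) && (chromatic_number (del_edge G e) < chromatic_number G).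

(* A subgraph of G is a pair S = (vertex set, edge set). *)
Definition is_subgraph (T : finType) (G : sgraph T)
    (S : {set T} * {set {set T}}) : bool :=
  (S.2 \subset edges G) && [forall e in S.2, e \subset S.1].

(* Meaningful when S is a subgraph: every element of S.2 is then of the form
   [set f x; f y]. *)
Definition subgraph_iso (U T : finType) (H : sgraph U)
    (S : {set T} * {set {set T}}) : bool :=
  [exists f : {ffun U -> T},
    [&& injectiveb f, f @: [set: U] == S.1
      & [forall x, forall y, adj H x y == ([set f x; f y] \in S.2)]]].

Definition copies (U T : finType) (H : sgraph U) (G : sgraph T) :
    {set {set T} * {set {set T}}} :=
  [set S | is_subgraph G S && subgraph_iso H S].

Definition ncopies (U T : finType) (H : sgraph U) (G : sgraph T) : nat :=
  #|copies H G|.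

Definition graph_free (U T : finType) (F : sgraph U) (G : sgraph T) : bool :=
  copies F G == set0.

(* Every n-vertex graph is isomorphic to one on 'I_n.  The maximum over an
   empty family would be 0, but the family is nonempty as soon as F has an
   edge, since the edgeless graph on 'I_n is then F-free. *)
Definition turan_ex (n : nat) (U V : finType) (H : sgraph U) (F : sgraph V) : nat :=
  \max_(G : sgraph 'I_n | graph_free F G) ncopies H G.

(* Main.v *)
(** Let [a, b >= 2]. Count the complete bipartite pairs [(A, B)] with [#|A| = a]
    and [#|B| = b]. Through an edge [xy] there are at most a binomial expression
    in the two degrees of them. If the graph has no triangle then
    [deg x + deg y <= n], so the total is at most a sum over the vertices of a
    weight depending on the degree only. Splitting the vertices into the
    neighbourhood [Y] of a vertex of maximum degree and its complement [X],
    each part contributes at most half of the optimum over the [K_{t,n-t}].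

    An F-free graph contains no [K_{s,s}] with an edge added inside a part,
    where [s] is the order of F. If all vertices lie in many bicliques, then all
    degrees are linear in [n], and this forces adjacent vertices to have boundedly
    many common neighbours. The bound for triangle-free graphs then holds up
    to a term of lower order, so if the number of bicliques is at least the
    optimum, all but linearly many pairs between [X] and [Y] are edges. A vertex
    then has boundedly many neighbours in one of the parts and, lying in many
    bicliques, more than two thirds of the other; so two adjacent vertices
    cannot be of the same kind, and there is no triangle. Otherwise one deletes
    a vertex lying in few bicliques; this increases the excess over the
    optimum, so it can be repeated only boundedly often. *)

Require Import Defs.
From mathcomp Require Import all_boot perm zify.

Set Implicit Arguments.
Unset Strict Implicit.
Unset Printing Implicit Defensive.

(** * Binomial estimates *)

Lemma leq_pow2r m n k : m <= n -> m ^ k <= n ^ k.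
Proof. by case: k => [//|k] mn; rewrite leq_exp2r. Qed.

Lemma leq_bin_exp n m : 'C(n, m) <= n ^ m.
Proof.
elim: m n => [|m IH] n; first by rewrite bin0.
apply: leq_trans (_ : m.+1 * 'C(n, m.+1) <= _); first exact: leq_pmull.
rewrite -mul_bin_diag expnS leq_mul2l (leq_trans (IH _)) ?orbT //.
exact/leq_pow2r/leq_pred.
Qed.

(** The right-hand side is the product $(m+1)\cdots(m+k)$, whose factors all exceed $m$. *)
Lemma exp_leq_fact_bin m k : m ^ k <= k`! * 'C(m + k, k).
Proof.
elim: k => [|k IH]; first by rewrite bin0.
rewrite expnS; apply: leq_trans (leq_mul (leqnn m) IH) _.
have E : (m + k).+1 * 'C(m + k, k) = k.+1 * 'C((m + k).+1, k.+1).
  exact: mul_bin_diag.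
rewrite factS addnS -(mulnA k.+1) [k.+1 * _]mulnCA -E mulnCA leq_mul2l.
by rewrite leq_mul2r leqW ?leq_addr ?orbT.
Qed.

Lemma leq_bin_pred n m : m.+1 * 'C(n, m.+1) <= n * 'C(n, m).
Proof. by rewrite -mul_bin_diag leq_mul2l leq_bin2l ?leq_pred ?orbT. Qed.

Lemma bin_shift n K m N : n + K <= N ->
  'C(n + K, m.+1) <= 'C(n, m.+1) + K * N ^ m.
Proof.
elim: K => [|K IH] nKN; first by rewrite addn0 mul0n addn0.
have {}IH := IH ltac:(lia); rewrite addnS binS.
have : 'C(n + K, m) <= N ^ m.
  by apply: leq_trans (leq_bin_exp _ _) _; apply: leq_pow2r; lia.
lia.
Qed.

(** * The optimum over complete bipartite graphs *)

Section BipartiteCount.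
Variables a b : nat.

(** Ordered pairs of sides are counted, so for [a = b] each copy of $K_{a,b}$ counts twice. This
    postpones the case distinction to the end. *)
Definition bip_count (n t : nat) : nat :=
  'C(t, a) * 'C(n - t, b) + 'C(t, b) * 'C(n - t, a).

Definition bip_max (n : nat) : nat := \max_(t < n.+1) bip_count n t.

Lemma leq_bip_max n t : t <= n -> bip_count n t <= bip_max n.
Proof. by move=> tn; apply: (leq_bigmax (Ordinal (tn : t < n.+1))). Qed.

Lemma bip_max_attained n : exists2 t, t <= n & bip_max n = bip_count n t.
Proof.
have [|t Et] := @eq_bigmax _ (fun t : 'I_n.+1 => bip_count n t).
  by rewrite card_ord.
by exists t => //; rewrite -ltnS.
Qed.
End BipartiteCount.

Section BipartiteGrowth.
Variables al be : nat.
Local Notation a := al.+2.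
Local Notation b := be.+2.

(* Adding a vertex to either side of the optimal partition of n, weighted by
   the sizes of the sides. *)
Lemma bip_max_step n :
  (a + b) * bip_max a b n + n * bip_max a b n <= n * bip_max a b n.+1.
Proof.
have [t tn ->] := bip_max_attained a b n.
set M := bip_max a b n.+1.
have HX : bip_count a b n.+1 t.+1 <= M by apply: leq_bip_max.
have HY : bip_count a b n.+1 t <= M by apply/leq_bip_max/leqW.
move: HX HY; rewrite /bip_count subSS subSn //.
set u := n - t; have -> : n = t + u by rewrite /u subnKC.
move: M => M {tn}; clearbody u; rewrite !binS.
have := leq_bin_pred t al.+1; have := leq_bin_pred t be.+1.
have := leq_bin_pred u al.+1; have := leq_bin_pred u be.+1.
move: ('C(t, a)) ('C(u, a)) ('C(t, b)) ('C(u, b)) => ta ua tb ub.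
move: ('C(t, al.+1)) ('C(u, al.+1)) ('C(t, be.+1)) ('C(u, be.+1)).
move=> ta' ua' tb' ub' H1 H2 H3 H4 HX HY.
have E1 : t * ((ta + ta') * ub + (tb + tb') * ua) <= t * M by rewrite leq_mul2l HX orbT.
have E2 : u * (ta * (ub + ub') + tb * (ua + ua')) <= u * M by rewrite leq_mul2l HY orbT.
have F1 : b * ub * ta <= u * ub' * ta by rewrite leq_mul2r H1 orbT.
have F2 : a * ua * tb <= u * ua' * tb by rewrite leq_mul2r H2 orbT.
have F3 : b * tb * ua <= t * tb' * ua by rewrite leq_mul2r H3 orbT.
have F4 : a * ta * ub <= t * ta' * ub by rewrite leq_mul2r H4 orbT.
lia.
Qed.

(** Deleting a vertex from the part of size [t.+1] loses two products, each of degree $a+b-1$. *)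
Lemma bip_max_diff n : bip_max a b n.+1 <= bip_max a b n + 2 * n ^ (al + be).+3.
Proof.
have [[|t] tn ->] := bip_max_attained a b n.+1; first by rewrite /bip_count !bin0n.
have := @leq_bip_max a b n t tn; rewrite /bip_count subSS !binS.
have C1 k u : u <= n -> 'C(u, k) <= n ^ k.
  by move=> un; apply: leq_trans (leq_bin_exp _ _) (leq_pow2r _ un).
have E1 : 'C(t, al.+1) * 'C(n - t, b) <= n ^ (al + be).+3.
  have -> : (al + be).+3 = al.+1 + b by lia.
  by rewrite expnD leq_mul ?C1 // leq_subr.
have E2 : 'C(t, be.+1) * 'C(n - t, a) <= n ^ (al + be).+3.
  have -> : (al + be).+3 = be.+1 + a by lia.
  by rewrite expnD leq_mul ?C1 // leq_subr.
lia.
Qed.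

Lemma bip_max_lower n : 2 * (a + b) <= n ->
  n ^ (a + b) <= 7 ^ (a + b) * (a`! * b`!) * bip_max a b n.
Proof.
(* The parts have at least [m + a] and [m + b] vertices, as [exp_leq_fact_bin] requires. The base 7
   comes from $n \le 7\lfloor n/4\rfloor$ for $n \ge 4$. *)
move=> hn; set m := n %/ 4; set t := m + a.
have tn : t <= n by rewrite /t /m; lia.
have H : m ^ (a + b) <= (a`! * b`!) * bip_max a b n.
  apply: (@leq_trans (a`! * b`! * bip_count a b n t)); last first.
    by rewrite leq_mul2l leq_bip_max ?orbT.
  have := leq_mul (exp_leq_fact_bin m a) (exp_leq_fact_bin m b).
  rewrite -expnD => /leq_trans; apply.
  rewrite mulnACA leq_mul2l; apply/orP; right; rewrite /bip_count.
  apply: leq_trans (leq_addr _ _); rewrite leq_mul2l leq_bin2l ?orbT //.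
  by rewrite /t /m; lia.
rewrite -mulnA; apply: leq_trans (leq_mul (leqnn _) H).
by rewrite -expnMn leq_pow2r // /m; lia.
Qed.
End BipartiteGrowth.

(** * Counting bicliques *)

Section Bicliques.
Variables (T : finType) (r : rel T).

Definition nbh (x : T) : {set T} := [set y | r x y].
Definition deg (x : T) : nat := #|nbh x|.

Definition bicliques (a b : nat) : {set {set T} * {set T}} :=
  [set P : {set T} * {set T} | [&& #|P.1| == a, #|P.2| == b & [forall x in P.1, P.2 \subset nbh x]]].

Definition bicliques_at (a b : nat) (v : T) : {set {set T} * {set T}} :=
  [set P in bicliques a b | (v \in P.1) || (v \in P.2)].

Lemma bicliquesP a b (P : {set T} * {set T}) :
  reflect [/\ #|P.1| = a, #|P.2| = b & forall x y, x \in P.1 -> y \in P.2 -> r x y]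
    (P \in bicliques a b).
Proof.
rewrite inE; apply: (iffP and3P) => [[/eqP -> /eqP -> /forall_inP H]|[-> -> H]].
  by split=> // x y /H/subsetP Hx /Hx; rewrite inE.
split=> //; apply/forall_inP => x xA; apply/subsetP => y yB.
by rewrite inE H.
Qed.

End Bicliques.

Section BicliqueBounds.
Variables (T : finType) (r : rel T).
Hypothesis rsym : symmetric r.
Variables a b : nat.
Local Notation deg := (deg r).
Local Notation nbh := (nbh r).
Local Notation bicl := (bicliques r a.+1 b.+1).

(** Removing [x] and [y] from the two sides is injective and leaves a [b]-subset of [nbh x :\ y] and
    an [a]-subset of [nbh y :\ x]. *)
Lemma leq_bicliques_edge x y :
  #|[set P in bicl | (x \in P.1) && (y \in P.2)]|
    <= (y \in nbh x) * ('C((deg x).-1, b) * 'C((deg y).-1, a)).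
Proof.
set E := [set _ in _ | _].
have [xy|nxy] := boolP (y \in nbh x); last first.
  rewrite leqn0 cards_eq0; apply/eqP/setP => P; rewrite in_set0.
  apply/negP => /setIdP[/bicliquesP[_ _ H] /andP[xA yB]].
  by move: nxy; rewrite inE H.
have yx : x \in nbh y by rewrite inE rsym; rewrite inE in xy.
pose h (P : {set T} * {set T}) := (P.1 :\ x, P.2 :\ y).
have h_inj : {in E &, injective h}.
  move=> [A B] [A' B'] /setIdP[_ /= /andP[xA yB]] /setIdP[_ /= /andP[xA' yB']].
  by case=> EA EB; rewrite -(setD1K xA) -(setD1K xA') -(setD1K yB) -(setD1K yB') EA EB.
rewrite -(card_in_imset h_inj) mul1n.
have -> : (deg x).-1 = #|nbh x :\ y| by rewrite [deg x](cardsD1 y) xy.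
have -> : (deg y).-1 = #|nbh y :\ x| by rewrite [deg y](cardsD1 x) yx.
rewrite -!cards_draws mulnC -cardsX subset_leq_card //.
apply/subsetP => _ /imsetP[[A B] /setIdP[/bicliquesP /= [cA cB H] /andP[xA yB]] ->].
rewrite !inE /= !setSD /=; first last.
- by apply/subsetP => z zA; rewrite inE rsym H.
- by apply/subsetP => z zB; rewrite inE H.
by move: cA cB; rewrite (cardsD1 x A) (cardsD1 y B) xA yB !add1n => -[->] [->]; rewrite !eqxx.
Qed.

Lemma sum_incidence (I J : finType) (S : {set I}) (R : I -> J -> bool) :
  \sum_(j : J) #|[set i in S | R i j]| = \sum_(i in S) #|[set j | R i j]|.
Proof.
transitivity (\sum_(j : J) \sum_(i in S) R i j).
  by apply: eq_bigr => j _; rewrite -sum1dep_card big_mkcondr.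
rewrite exchange_big; apply: eq_bigr => i _.
by rewrite -sum1dep_card [RHS]big_mkcond.
Qed.

Lemma leq_bicliques :
  a.+1 * b.+1 * #|bicl|
    <= \sum_x \sum_(y in nbh x) 'C((deg x).-1, b) * 'C((deg y).-1, a).
Proof.
apply: leq_trans (_ : \sum_x \sum_y #|[set P in bicl | (x \in P.1) && (y \in P.2)]| <= _).
  rewrite pair_big sum_incidence /= mulnC -sum_nat_const eq_leq //.
  apply: eq_bigr => P /bicliquesP[cA cB _].
  by rewrite -cA -cB -cardsX; apply: eq_card => -[x y]; rewrite !inE.
apply: leq_sum => x _; rewrite [in leqRHS]big_mkcond; apply: leq_sum => y _.
by apply: leq_trans (leq_bicliques_edge x y) _; case: ifP; rewrite ?mul1n.
Qed.

(** A biclique with [v] in its first side has [b.+1] edges at [v], one with [v] in its second side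
    has [a.+1]; the factors in the sum bring both counts to a common multiple. *)
Lemma leq_bicliques_at v :
  a.+1 * b.+1 * #|bicliques_at r a.+1 b.+1 v|
    <= \sum_(y in nbh v) (a.+1 * ('C((deg v).-1, b) * 'C((deg y).-1, a))
                        + b.+1 * ('C((deg y).-1, b) * 'C((deg v).-1, a))).
Proof.
pose EA := [set P in bicl | v \in P.1]; pose EB := [set P in bicl | v \in P.2].
have HA : b.+1 * #|EA| <= \sum_(y in nbh v) 'C((deg v).-1, b) * 'C((deg y).-1, a).
  have -> : b.+1 * #|EA| = \sum_(P in EA) #|[set y | y \in P.2]|.
    rewrite mulnC -sum_nat_const; apply: eq_bigr => P.
    by case/setIdP=> /bicliquesP[_ <- _] _; rewrite cardsE.
  rewrite -(sum_incidence EA (fun P y => y \in P.2)) [in leqRHS]big_mkcond.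
  apply: leq_sum => y _; have := leq_bicliques_edge v y.
  case: ifP => _; rewrite ?mul1n ?mul0n; apply: leq_trans; apply: eq_leq;
    by apply: eq_card => P; rewrite !inE -!andbA.
have HB : a.+1 * #|EB| <= \sum_(y in nbh v) 'C((deg y).-1, b) * 'C((deg v).-1, a).
  have -> : a.+1 * #|EB| = \sum_(P in EB) #|[set y | y \in P.1]|.
    rewrite mulnC -sum_nat_const; apply: eq_bigr => P.
    by case/setIdP=> /bicliquesP[<- _ _] _; rewrite cardsE.
  rewrite -(sum_incidence EB (fun P y => y \in P.1)) [in leqRHS]big_mkcond.
  apply: leq_sum => y _; have := leq_bicliques_edge y v.
  have -> : (v \in nbh y) = (y \in nbh v) by rewrite !inE rsym.
  case: ifP => _; rewrite ?mul1n ?mul0n; apply: leq_trans; apply: eq_leq;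
    by apply: eq_card => P; rewrite !inE -!andbA; do !bool_congr; rewrite andbC.
have : #|bicliques_at r a.+1 b.+1 v| <= #|EA| + #|EB|.
  apply: leq_trans (leq_card_setU EA EB); apply: subset_leq_card.
  by apply/subsetP => P; rewrite !inE => /andP[-> /orP[]->]; rewrite ?orbT.
rewrite big_split /=.
move: HA HB; set SA := \sum_(y in _) _; set SB := \sum_(y in _) _ => HA HB H.
rewrite -[X in _ <= X + _](big_distrr a.+1) -[X in _ <= _ + X](big_distrr b.+1) /=.
rewrite -/SA -/SB.
have {}HA : a.+1 * (b.+1 * #|EA|) <= a.+1 * SA by rewrite leq_mul2l HA orbT.
have {}HB : b.+1 * (a.+1 * #|EB|) <= b.+1 * SB by rewrite leq_mul2l HB orbT.
have {}H : a.+1 * b.+1 * #|bicliques_at r a.+1 b.+1 v| <= a.+1 * b.+1 * (#|EA| + #|EB|).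
  by rewrite leq_mul2l H orbT.
apply: leq_trans H _; rewrite mulnDr leq_add -?mulnA //.
by rewrite mulnCA.
Qed.
End BicliqueBounds.

Section Deletion.
Variables (T : finType) (r : rel T) (v : T).
Local Notation T' := {x : T | x != v}.

Definition del_vertex : rel T' := relpre val r.

Lemma card_del_vertex : #|{: T'}| = #|T|.-1.
Proof. by rewrite card_sig -(cardC1 v); apply: eq_card => x; rewrite !inE. Qed.

Lemma leq_bicliques_del a b :
  #|bicliques r a b| <= #|bicliques del_vertex a b| + #|bicliques_at r a b v|.
Proof.
rewrite -(cardsID [set P : {set T} * {set T} | (v \in P.1) || (v \in P.2)]) addnC leq_add //; last first.
  by apply/eq_leq/eq_card => P; rewrite !inE.
set E := _ :\: _.
pose h (P : {set T} * {set T}) : {set T'} * {set T'} := (val @^-1: P.1, val @^-1: P.2).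
have valK (A : {set T}) : v \notin A -> val @: (val @^-1: A : {set T'}) = A.
  move=> vA; apply/setP => x; apply/imsetP/idP => [[y]|xA]; first by rewrite inE => + ->.
  have xv : x != v by apply: contraNneq vA => <-.
  by exists (exist _ x xv); rewrite ?inE.
have EP P : P \in E -> [/\ P \in bicliques r a b, v \notin P.1 & v \notin P.2].
  by case/setDP => ->; rewrite inE => /norP[].
have h_inj : {in E &, injective h}.
  move=> [A B] [A' B'] /EP[_ /= vA vB] /EP[_ /= vA' vB'] [EA EB].
  by rewrite -(valK _ vA) -(valK _ vB) -(valK _ vA') -(valK _ vB') EA EB.
rewrite -(card_in_imset h_inj); apply/subset_leq_card/subsetP.
move=> _ /imsetP[[A B] /EP[/bicliquesP[/= cA cB H] vA vB] ->].
apply/bicliquesP; split=> /=.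
- by rewrite -(card_imset _ val_inj) valK.
- by rewrite -(card_imset _ val_inj) valK.
- by move=> x y; rewrite !inE; apply: H.
Qed.
End Deletion.
Arguments del_vertex {T} r v.

(** * Degree sums and the triangle-free case *)

Section EdgeWeight.
Variables a b : nat.

(* Bounds the number of bicliques through an edge with end degrees p and q. *)
Definition edge_weight (p q : nat) : nat :=
  'C(p.-1, b) * 'C(q.-1, a) + 'C(q.-1, b) * 'C(p.-1, a).

Lemma edge_weight_mono p p' q q' :
  p <= p' -> q <= q' -> edge_weight p q <= edge_weight p' q'.
Proof. by move=> pp' qq'; rewrite leq_add // leq_mul // leq_bin2l //; lia. Qed.

(** The total edge weight at a vertex of degree [p] whose neighbours all have degree [n - p], as in
    $K_{p,n-p}$. *)
Definition vertex_weight (n p : nat) : nat := p * edge_weight p (n - p).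

(** Each edge of $K_{p,n-p}$ has one end in the part of size [n - p], whose vertices have degree
    [p]; summing the weights there counts each biclique once per edge. *)
Lemma vertex_weightE n p :
  vertex_weight n p * (n - p) = a.+1 * b.+1 * bip_count a.+1 b.+1 n p.
Proof.
rewrite /vertex_weight /edge_weight /bip_count; set q := n - p.
have Ea k : k * 'C(k.-1, a) = a.+1 * 'C(k, a.+1) by exact: mul_bin_diag.
have Eb k : k * 'C(k.-1, b) = b.+1 * 'C(k, b.+1) by exact: mul_bin_diag.
transitivity ((p * 'C(p.-1, b)) * (q * 'C(q.-1, a)) + (q * 'C(q.-1, b)) * (p * 'C(p.-1, a))).
  by lia.
by rewrite !Ea !Eb; lia.
Qed.

Definition scaled_max (n : nat) : nat := a.+1 * b.+1 * bip_max a.+1 b.+1 n.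

Lemma vertex_weight_le n p : p <= n -> vertex_weight n p * (n - p) <= scaled_max n.
Proof. by move=> pn; rewrite vertex_weightE leq_mul2l leq_bip_max ?orbT. Qed.
End EdgeWeight.

Section DegreeSums.
Variables (T : finType) (r : rel T).
Hypotheses (rsym : symmetric r) (rirr : irreflexive r).
Local Notation deg := (deg r).
Local Notation nbh := (nbh r).

Lemma deg_leq x : deg x <= #|T|.
Proof. exact: max_card. Qed.

Lemma deg_codeg x y : deg x + deg y <= #|T| + #|nbh x :&: nbh y|.
Proof. by rewrite -cardsUI leq_add2r max_card. Qed.

Lemma card_nonnbh x : #|~: nbh x| = #|T| - deg x.
Proof. by rewrite cardsCs setCK. Qed.

Lemma nonnbh_gt0 x : 0 < #|T| - deg x.
Proof. by rewrite -card_nonnbh; apply/card_gt0P; exists x; rewrite !inE rirr. Qed.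

Lemma exists_max_deg (x1 : T) : exists x0, forall x, deg x <= deg x0.
Proof. by case: (@arg_maxnP _ x1 predT deg) => // x0 _ H; exists x0 => x; apply: H. Qed.

Section Weights.
Variables a b : nat.
Local Notation n := #|T|.
Local Notation F := (scaled_max a b n).
Local Notation bicl := (bicliques r a.+1 b.+1).

Lemma edge_sum_sym (w : T -> T -> nat) :
  \sum_x \sum_(y in nbh x) w x y = \sum_x \sum_(y in nbh x) w y x.
Proof.
rewrite (exchange_big_dep predT) //=; apply: eq_bigr => y _.
by apply: eq_bigl => x; rewrite !inE rsym.
Qed.

Lemma leq_bicliques_edge_weight :
  2 * (a.+1 * b.+1 * #|bicl|) <= \sum_x \sum_(y in nbh x) edge_weight a b (deg x) (deg y).
Proof.
have H := leq_bicliques rsym a b.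
rewrite mul2n -addnn; apply: leq_trans (leq_add H H) _.
rewrite [X in _ + X <= _]edge_sum_sym -big_split /=.
by apply/eq_leq/eq_bigr => x _; rewrite -big_split.
Qed.

Lemma leq_bicliques_vertex_weight err :
    (forall x y, r x y ->
       edge_weight a b (deg x) (deg y) <= edge_weight a b (deg x) (n - deg x) + err) ->
  2 * (a.+1 * b.+1 * #|bicl|) <= \sum_x vertex_weight a b n (deg x) + n * (n * err).
Proof.
move=> Herr; apply: leq_trans leq_bicliques_edge_weight _.
rewrite -(sum_nat_const T (n * err)) -big_split /=; apply: leq_sum => x _.
apply: leq_trans (_ : \sum_(y in nbh x) (edge_weight a b (deg x) (n - deg x) + err) <= _).
  by apply: leq_sum => y; rewrite inE; apply: Herr.
by rewrite sum_nat_const mulnDr leq_add2l leq_mul2r deg_leq orbT.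
Qed.

Variable x0 : T.
Hypothesis x0max : forall x, deg x <= deg x0.

(** There are [n - deg x0] summands, and by maximality of [deg x0] each is at most [F] divided by
    that number. *)
Lemma sum_vertex_weight_nonnbh :
  \sum_(x in ~: nbh x0) vertex_weight a b n (deg x) <= F.
Proof.
rewrite -(leq_pmul2r (nonnbh_gt0 x0)) big_distrl /=.
apply: leq_trans (_ : \sum_(x in ~: nbh x0) F <= _); last first.
  by rewrite sum_nat_const card_nonnbh mulnC.
apply: leq_sum => x _; apply: leq_trans (vertex_weight_le a b (deg_leq x)).
by rewrite leq_mul2l leq_sub2l ?orbT.
Qed.

Lemma sum_vertex_weight :
  \sum_x vertex_weight a b n (deg x) <=
  F + \sum_(x in nbh x0) vertex_weight a b n (deg x).
Proof.
rewrite (bigID (mem (nbh x0))) /= addnC leq_add2r.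
by apply: leq_trans sum_vertex_weight_nonnbh; apply/eq_leq/eq_bigl => x; rewrite in_setC.
Qed.

End Weights.

Lemma bicliques_triangle_free a b :
    (forall x y, r x y -> nbh x :&: nbh y = set0) ->
  #|bicliques r a.+1 b.+1| <= bip_max a.+1 b.+1 #|T|.
Proof.
move=> tf; rewrite -(@leq_pmul2l (2 * (a.+1 * b.+1))) //.
have Hdeg x y : r x y -> deg y <= #|T| - deg x.
  by move=> xy; have := deg_codeg x y; rewrite tf // cards0; lia.
have H : 2 * (a.+1 * b.+1 * #|bicliques r a.+1 b.+1|) <=
    \sum_x vertex_weight a b #|T| (deg x) + #|T| * (#|T| * 0).
  apply: leq_bicliques_vertex_weight => x y xy; rewrite addn0.
  by apply: edge_weight_mono => //; apply: Hdeg.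
rewrite -mulnA; apply: leq_trans H _; rewrite !muln0 addn0.
have [/card0_eq T0|/card_gt0P[x1 _]] := posnP #|T|; first by rewrite big_pred0.
have [x0 x0max] := exists_max_deg x1.
apply: leq_trans (sum_vertex_weight a b x0max) _.
rewrite -mulnA mul2n -addnn leq_add2l.
have [D0|Dpos] := posnP (deg x0); first by rewrite (cards0_eq D0) big_set0.
rewrite -(leq_pmul2r Dpos) big_distrl /=.
apply: leq_trans (_ : \sum_(x in nbh x0) scaled_max a b #|T| <= _); last first.
  by rewrite sum_nat_const mulnC.
(* A neighbour of [x0] has degree at most [n - deg x0], so its weight times [deg x0] is at most the
   scaled optimum. *)
apply: leq_sum => x; rewrite inE => /Hdeg x0x.
apply: leq_trans (vertex_weight_le a b (deg_leq x)).
by rewrite leq_mul2l; apply/orP; right; have := deg_leq x0; lia.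
Qed.

End DegreeSums.

(** The first side may lie in [X] or in [Y]; as it is nonempty, no pair arises in both ways. *)
Lemma bip_count_leq_bicliques (T : finType) (r : rel T) (X Y : {set T}) n t a b :
    #|X| = t -> #|Y| = n - t -> [disjoint X & Y] -> symmetric r ->
    (forall x y, x \in X -> y \in Y -> r x y) -> 0 < a ->
  bip_count a b n t <= #|bicliques r a b|.
Proof.
move=> cX cY dXY rsym H a0.
pose D (A B : {set T}) := setX [set A' : {set T} | A' \subset A & #|A'| == a]
                               [set B' : {set T} | B' \subset B & #|B'| == b].
have -> : bip_count a b n t = #|D X Y| + #|D Y X|.
  by rewrite !cardsX !cards_draws cX cY /bip_count [_ * 'C(t, b)]mulnC.
have DI : D X Y :&: D Y X = set0.
  apply/eqP; rewrite -subset0; apply/subsetP => -[A B]; rewrite !inE /=.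
  case/andP => /andP[/andP[AX cA] _] /andP[/andP[AY _] _].
  have [x xA] : exists x, x \in A by apply/card_gt0P; rewrite (eqP cA).
  by have := disjointFr dXY (subsetP AX _ xA); rewrite (subsetP AY _ xA).
rewrite -cardsUI DI cards0 addn0; apply/subset_leq_card/subsetP => -[A B].
rewrite !inE /= => /orP[]/andP[/andP[sA ->]/andP[sB ->]] /=;
  apply/forall_inP => x xA; apply/subsetP => y yB; rewrite inE.
  by apply: H; [apply: (subsetP sA) | apply: (subsetP sB)].
by rewrite rsym; apply: H; [apply: (subsetP sB) | apply: (subsetP sA)].
Qed.

Lemma leq_bicliques_exp (T : finType) (r : rel T) a b :
  #|bicliques r a b| <= 2 ^ #|T| * 2 ^ #|T|.
Proof.
apply: leq_trans (max_card _) _.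
by rewrite card_prod -!cardsT -powersetT card_powerset cardsT.
Qed.

(* No copy of K_{s,s} with an edge added inside one of its parts. *)
Definition plus_free (T : finType) (r : rel T) (s : nat) : Prop :=
  forall (A B : {set T}) (u v : T), s <= #|A| -> s <= #|B| ->
    (forall x y, x \in A -> y \in B -> r x y) ->
    u \in A -> v \in A -> ~~ r u v.

(* Among 2ks common neighbours of u and v, each of degree at least n/k, some
   s have many common neighbours: by averaging, n/2k vertices see at least s of
   the 2ks, and by pigeonhole s of those see the same set. *)
Lemma codeg_plus_free (T : finType) (r : rel T) (s k : nat) :
    symmetric r -> plus_free r s -> 0 < s -> 0 < k ->
    2 * k * s * 2 ^ (2 * k * s) <= #|T| -> (forall v, #|T| <= k * deg r v) ->
  forall u v, r u v -> #|nbh r u :&: nbh r v| <= 2 * k * s.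
Proof.
move=> rsym pf s0 k0 nbig mindeg u v uv; rewrite leqNgt; apply/negP => cW.
set K := 2 * k * s in nbig cW *; set n := #|T| in nbig mindeg *.
have [W sW cardW] : exists2 W : {set T}, W \subset nbh r u :&: nbh r v & #|W| = K.
  have : [set A : {set T} | A \subset nbh r u :&: nbh r v & #|A| == K] != set0.
    by rewrite -card_gt0 cards_draws bin_gt0 ltnW.
  by case/set0Pn => A; rewrite inE => /andP[sA /eqP]; exists A.
pose Z := [set y | s <= #|nbh r y :&: W|].
have cZ : n <= 2 * k * #|Z|.
  have D1 : K * n <= k * \sum_y #|nbh r y :&: W|.
    have -> : \sum_y #|nbh r y :&: W| = \sum_(w in W) deg r w.
      transitivity (\sum_y #|[set w in W | r y w]|).
        by apply: eq_bigr => y _; apply: eq_card => w; rewrite !inE andbC.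
      rewrite (sum_incidence W (fun w y => r y w)).
      by apply: eq_bigr => w _; apply: eq_card => y; rewrite !inE rsym.
    rewrite -cardW -sum_nat_const big_distrr /=; apply: leq_sum => w _; exact: mindeg.
  have D2 : \sum_y #|nbh r y :&: W| <= #|Z| * K + n * s.
    rewrite (bigID (mem Z)) /= leq_add //.
      rewrite -sum_nat_const; apply: leq_sum => y _.
      by rewrite -cardW subset_leq_card ?subsetIr.
    rewrite -sum_nat_const [leqRHS](bigID (mem Z)) /=; apply: leq_trans (leq_addl _ _).
    by apply: leq_sum => y; rewrite inE -ltnNge; apply: ltnW.
  rewrite -(@leq_pmul2l (k * s)) ?muln_gt0 ?k0 //.
  by move: D1 D2; rewrite /K; nia.
have [S /andP[sS cS]] : exists S : {set T},
    (s <= #|S|) && (s <= #|[set y in Z | nbh r y :&: W == S]|).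
  apply/existsP; apply: contraLR nbig; rewrite negb_exists -ltnNge => /forallP H.
  have cZ2 : #|Z| = \sum_(S in powerset W) #|[set y in Z | nbh r y :&: W == S]|.
    rewrite -[LHS]sum1_card (partition_big (fun y => nbh r y :&: W) (mem (powerset W))) /=.
      by apply: eq_bigr => S _; rewrite sum1dep_card.
    by move=> y _; rewrite inE subsetIr.
  have cZ3 : #|Z| <= 2 ^ K * s.-1.
    rewrite cZ2 -cardW -card_powerset -sum_nat_const; apply: leq_sum => S _.
    have := H S; rewrite negb_and -!ltnNge => /orP[sS|]; last by lia.
    rewrite (_ : [set _ in _ | _] = set0) ?cards0 //; apply/setP => y; rewrite !inE.
    by apply/negP => /andP[+ /eqP E]; rewrite E leqNgt sS.
  apply: leq_ltn_trans cZ _.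
  apply: leq_ltn_trans (leq_mul (leqnn _) cZ3) _.
  have := expn_gt0 2 K; rewrite /K.
  by nia.
set Y := [set y in Z | _] in cS.
have YS y w : y \in Y -> w \in S -> r y w.
  by rewrite inE => /andP[_ /eqP <-]; rewrite !inE => /andP[].
have SW w : w \in S -> w \in W.
  have /card_gt0P[y] : 0 < #|Y| by lia.
  by rewrite inE => /andP[_ /eqP <-]; rewrite inE => /andP[].
(* Both [u] and [v] see all of [W], hence of [S], so they can join [Y] on one side; the edge [uv]
   then lies inside that side. *)
have := pf (u |: (v |: Y)) S u v; rewrite uv => /(_ _ sS) H.
have : false; last by [].
apply: H; rewrite ?(setU11, setU1r _ (setU11 _ _)) //.
  by apply: leq_trans cS _; apply: subset_leq_card; rewrite setUA subsetUr.
move=> x y + yS; have := subsetP sW _ (SW _ yS); rewrite !inE => /andP[uy vy].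
by case/or3P => [/eqP->|/eqP->|yY] //; apply: YS; rewrite ?inE.
Qed.

(** * Stability of the weights under bounded changes of degree *)

Lemma bin_prod_shift p q K u w n : p <= n -> q <= n -> K <= n ->
  'C(p.-1, w.+1) * 'C((q + K).-1, u.+1)
    <= 'C(p.-1, w.+1) * 'C(q.-1, u.+1) + K * 2 ^ u * n ^ (u + w).+1.
Proof.
move=> pn qn Kn.
have H : 'C((q + K).-1, u.+1) <= 'C(q.-1, u.+1) + K * (2 * n) ^ u.
  by apply: leq_trans (bin_shift (n := q.-1) (N := 2 * n) u _); first apply: leq_bin2l; lia.
apply: leq_trans (leq_mul (leqnn _) H) _; rewrite mulnDr leq_add2l.
rewrite expnMn -addnS expnD mulnC -!mulnA leq_mul2l; apply/orP; right.
rewrite leq_mul2l; apply/orP; right; rewrite leq_mul2l; apply/orP; right.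
apply: leq_trans (leq_bin_exp _ _) _; apply: leq_pow2r; lia.
Qed.

Lemma leq_bin_prod p q u w n : p <= n -> q <= n ->
  'C(p.-1, w) * 'C(q.-1, u) <= n ^ (u + w).
Proof.
move=> pn qn; rewrite mulnC expnD leq_mul //;
by apply: leq_trans (leq_bin_exp _ _) _; apply: leq_pow2r; lia.
Qed.

(* Bounds the bicliques at a vertex of degree p through a given neighbour of
   degree q. *)
Definition star_weight (a b p q : nat) : nat :=
  a.+1 * ('C(p.-1, b) * 'C(q.-1, a)) + b.+1 * ('C(q.-1, b) * 'C(p.-1, a)).

Lemma star_weight_mono a b p p' q q' :
  p <= p' -> q <= q' -> star_weight a b p q <= star_weight a b p' q'.
Proof.
by move=> pp' qq'; rewrite leq_add // leq_mul // leq_mul // leq_bin2l //; lia.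
Qed.

Lemma star_weight_sym a b p q :
  star_weight a b p q + star_weight a b q p = (a.+1 + b.+1) * edge_weight a b p q.
Proof. rewrite /star_weight /edge_weight; lia. Qed.

Section Shift.
Variables al be : nat.
Local Notation h := (al.+2 + be.+2).
Local Notation L := (al + be).

(** The weight has order $n^{L+2}$, so raising a degree by a constant [K] costs only order
    $n^{L+1}$. *)
Lemma edge_weight_shift p q K n : p <= n -> q <= n -> K <= n ->
  edge_weight al.+1 be.+1 p (q + K)
    <= edge_weight al.+1 be.+1 p q + K * 2 ^ L.+1 * n ^ L.+1.
Proof.
move=> pn qn Kn; rewrite /edge_weight.
have H1 := bin_prod_shift al be pn qn Kn.
have H2 := bin_prod_shift be al pn qn Kn.
have H3 : K * 2 ^ al * n ^ L.+1 <= K * 2 ^ L * n ^ L.+1.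
  by rewrite leq_mul2r leq_mul2l leq_pexp2l ?leq_addr ?orbT.
have H4 : K * 2 ^ be * n ^ L.+1 <= K * 2 ^ L * n ^ L.+1.
  by rewrite leq_mul2r leq_mul2l leq_pexp2l ?leq_addl ?orbT.
rewrite (addnC be al) in H2; rewrite [2 ^ L.+1]expnS; lia.
Qed.

Lemma star_weight_shift p q K n : p <= n -> q <= n -> K <= n ->
  star_weight al.+1 be.+1 p (q + K)
    <= star_weight al.+1 be.+1 p q + h * K * 2 ^ L * n ^ L.+1.
Proof.
move=> pn qn Kn; rewrite /star_weight.
have H1 := bin_prod_shift al be pn qn Kn.
have H2 := bin_prod_shift be al pn qn Kn.
have H3 : K * 2 ^ al * n ^ L.+1 <= K * 2 ^ L * n ^ L.+1.
  by rewrite leq_mul2r leq_mul2l leq_pexp2l ?leq_addr ?orbT.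
have H4 : K * 2 ^ be * n ^ L.+1 <= K * 2 ^ L * n ^ L.+1.
  by rewrite leq_mul2r leq_mul2l leq_pexp2l ?leq_addl ?orbT.
rewrite (addnC be al) in H2.
have {}H1 := leq_mul (leqnn al.+2) (leq_trans H1 (leq_add (leqnn _) H3)).
have {}H2 := leq_mul (leqnn be.+2) (leq_trans H2 (leq_add (leqnn _) H4)).
rewrite ['C((q + K).-1, _) * _]mulnC ['C(q.-1, be.+1) * _]mulnC; lia.
Qed.

Lemma star_weight_shift_l p q K n : p <= n -> q <= n -> K <= n ->
  star_weight al.+1 be.+1 (p + K) q
    <= star_weight al.+1 be.+1 p q + h * K * 2 ^ L * n ^ L.+1.
Proof.
move=> pn qn Kn; rewrite /star_weight.
have H1 := bin_prod_shift be al qn pn Kn.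
have H2 := bin_prod_shift al be qn pn Kn.
have H3 : K * 2 ^ al * n ^ L.+1 <= K * 2 ^ L * n ^ L.+1.
  by rewrite leq_mul2r leq_mul2l leq_pexp2l ?leq_addr ?orbT.
have H4 : K * 2 ^ be * n ^ L.+1 <= K * 2 ^ L * n ^ L.+1.
  by rewrite leq_mul2r leq_mul2l leq_pexp2l ?leq_addl ?orbT.
rewrite (addnC be al) in H1.
have {}H1 := leq_mul (leqnn al.+2) (leq_trans H1 (leq_add (leqnn _) H4)).
have {}H2 := leq_mul (leqnn be.+2) (leq_trans H2 (leq_add (leqnn _) H3)).
rewrite ['C((p + K).-1, be.+1) * _]mulnC ['C(p.-1, be.+1) * _]mulnC; lia.
Qed.

Lemma leq_star_weight p q n : p <= n -> q <= n ->
  star_weight al.+1 be.+1 p q <= h * n ^ L.+2.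
Proof.
move=> pn qn; rewrite mulnDl leq_add // leq_mul //.
  by apply: leq_trans (leq_bin_prod _ _ pn qn) _; rewrite addSn addnS.
by apply: leq_trans (leq_bin_prod _ _ qn pn) _; rewrite addSn addnS.
Qed.
End Shift.

(** Divided by $nF$, the claim is $Dw/F \le 1-(n-D-d)/n+2kK/n$: a neighbour of a vertex of maximum
    degree [D] loses weight in proportion to the shortfall of its degree [d] from $n-D$. *)
Lemma vertex_weight_slack n D K k F w d :
    d + D <= n + K -> d <= n -> D <= n -> w * (n - d) <= F ->
    n <= k * D -> 2 * k * K <= n -> 0 < n ->
  F * (n - D) + n * D * w <= n * F + F * d + 2 * k * K * F.
Proof.
move=> dD dn Dn wF nD Kn n0.
have [e def_n] : exists e, n = d + e by exists (n - d); lia.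
have {}wF : w * e <= F by move: wF; rewrite def_n addKn.
have [x def_x] : exists x, n = D + x by exists (n - D); lia.
have -> : n - D = x by lia.
have De : D <= e + K by lia.
have [le_De|lt_eD] := leqP D e.
  have e0 : 0 < e by nia.
  rewrite -(leq_pmul2r e0).
  have : n * D * (w * e) <= n * D * F by rewrite leq_mul2l wF orbT.
  have [i ei] : exists i, e = D + i by exists (e - D); lia.
  have dx : x = d + i by lia.
  have -> : n * D * (w * e) = n * D * w * e by lia.
  rewrite mulnDl => H; apply: leq_trans (leq_add (leqnn _) H) _.
  by rewrite dx def_n ei; nia.
(* Here [d] exceeds [n - D], but by at most [K]; since [e] is linear in [n], the ratio $D/e$ is at
   most $1+2kK/n$. *)
have e2 : n <= 2 * k * e by nia.
have e0 : 0 < e by nia.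
rewrite -(leq_pmul2r e0).
have H : n * D * (w * e) <= n * D * F by rewrite leq_mul2l wF orbT.
have H2 : n * D <= n * e + n * K by nia.
have H3 : n * K <= 2 * k * e * K by rewrite leq_mul2r e2 orbT.
have H4 : n * D * F <= (n * e + 2 * k * e * K) * F by rewrite leq_mul2r; apply/orP; right; lia.
have xd : x <= d by lia.
have H5 : F * x * e <= F * d * e by rewrite !leq_mul2r leq_mul2l xd !orbT.
lia.
Qed.

(** * Graphs in which every vertex lies in many bicliques *)

Section Structure.
Variables al be k K c1 c2 : nat.
Local Notation a := al.+2.
Local Notation b := be.+2.
Local Notation h := (a + b).
Local Notation L := (al + be).

(* Error terms; none depends on the number n of vertices. *)
Let shift K' := h * K' * 2 ^ L.
(** [gap] bounds the average degree deficit over [Y], [miss * n] the missing pairs between [X] and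
    [Y], and [few] the neighbours of a vertex in one of the parts. The later constants compare [D]
    with star sums. *)
Let gap := 2 * k * K + K * 2 ^ L.+1 * c1.
Let miss := gap + K.
Let few := 2 * k * (miss + K).
Let c6 := a * b * (2 * h).
Let c8 := shift K + K * h.
Let c9 := 2 * k * (c6 + c8).
Let c10 := 2 * c9 + 3 * (shift K + shift few + few * h).
Definition structure_threshold := c2 * c10 + few + 6 * k * K.

Variables (T : finType) (r : rel T).
Hypotheses (rsym : symmetric r) (rirr : irreflexive r).
Local Notation deg := (deg r).
Local Notation nbh := (nbh r).
Local Notation n := #|T|.
Local Notation F := (scaled_max al.+1 be.+1 n).
Local Notation psi := (star_weight al.+1 be.+1).
(** In the application [D] is $ab$ times the increment of the optimum from $n-1$ to $n$ vertices.
    [F_D] bounds the average contribution of a vertex to the optimum by [D], up to lower order. *)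
Variable D : nat.
Hypotheses (n_big : structure_threshold < n)
  (mindeg : forall v, n <= k * deg v)
  (codeg : forall x y, r x y -> #|nbh x :&: nbh y| <= K)
  (Q_big : bip_max a b n <= #|bicliques r a b|)
  (F_big : n ^ L.+4 <= c1 * F)
  (D_big : n ^ L.+3 <= c2 * D)
  (F_D : h * F <= n * D + c6 * n ^ L.+3)
  (D_at : forall v, D <= a * b * #|bicliques_at r a b v|).
Variable x0 : T.
Hypothesis x0max : forall x, deg x <= deg x0.

Let Y := nbh x0.
Let X := ~: nbh x0.
Let d := deg x0.
Let x := n - d.

Let n_gt0 : 0 < n. Proof. exact: leq_ltn_trans n_big. Qed.
Let k_gt0 : 0 < k. Proof. by have := mindeg x0; case: k => //; lia. Qed.
Let few_lt : few < n. Proof. by move: n_big; rewrite /structure_threshold; lia. Qed.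
Let kK_lt : 6 * k * K < n. Proof. by move: n_big; rewrite /structure_threshold; lia. Qed.
Let c10_lt : c2 * c10 < n. Proof. by move: n_big; rewrite /structure_threshold; lia. Qed.
Let K_few : K <= few. Proof.
rewrite /few mulnDr; apply: leq_trans (leq_addl _ _).
by rewrite leq_pmull // muln_gt0.
Qed.
Let d_le : d <= n. Proof. exact: deg_leq. Qed.
Let dx : d + x = n. Proof. by rewrite /x; lia. Qed.
Let n_kd : n <= k * d. Proof. exact: mindeg. Qed.
Let d_gt0 : 0 < d.
Proof. by move: n_kd n_gt0; case: d; rewrite ?muln0; lia. Qed.
Let card_X : #|X| = x. Proof. exact: card_nonnbh. Qed.
Let deg_adj u v : r u v -> deg u + deg v <= n + K.
Proof. by move=> /codeg H; apply: leq_trans (deg_codeg r u v) _; rewrite leq_add2l. Qed.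

Let d_sum m : d * m = \sum_(y in Y) m.
Proof. by rewrite sum_nat_const. Qed.

Let n_kx : n <= 2 * k * x.
Proof.
have /card_gt0P[y] : 0 < #|Y| by exact: d_gt0.
rewrite inE => /deg_adj H; have Hy := mindeg y.
have {H} : k * deg y <= k * (x + K) by rewrite leq_mul2l; move: dx H; rewrite -/d; lia.
by move: kK_lt; lia.
Qed.

(** By [Q_big] the vertex weights sum to at least [2 * F] up to lower order. Since [X] carries at
    most [F], almost [F] falls on [Y], and [vertex_weight_slack] turns this into large degrees in
    [Y]. *)
Lemma structure_slack :
  d * x <= \sum_(y in Y) deg y + gap * d.
Proof.
have F_gt0 : 0 < F by move: F_big (expn_gt0 n L.+4); rewrite n_gt0; case: F; rewrite ?muln0; lia.
have H1 : 2 * F <= \sum_x0 vertex_weight al.+1 be.+1 n (deg x0)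
                  + n * (n * (K * 2 ^ L.+1 * n ^ L.+1)).
  apply: leq_trans (leq_bicliques_vertex_weight rsym _).
    by rewrite leq_mul2l leq_mul2l Q_big !orbT.
  move=> u v uv; have H := deg_adj uv.
  apply: leq_trans (edge_weight_shift _ _ _ _ _) => //; last by lia.
  - by apply: edge_weight_mono => //; have := deg_leq r u; lia.
  - exact: deg_leq.
  - exact: leq_subr.
have {}H1 : F <= \sum_(y in Y) vertex_weight al.+1 be.+1 n (deg y)
              + K * 2 ^ L.+1 * n ^ L.+3.
  have := sum_vertex_weight rirr al.+1 be.+1 x0max.
  have E m : n * (n * (m * n ^ L.+1)) = m * n ^ L.+3 by rewrite [n ^ L.+3]expnS [n ^ L.+2]expnS; lia.
  by move: H1; rewrite -/Y E; lia.
set S := \sum_(y in Y) vertex_weight _ _ _ _ in H1.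
have H2 : d * (F * x) + n * d * S <= d * (n * F) + F * \sum_(y in Y) deg y + d * (2 * k * K * F).
  rewrite !d_sum !big_distrr /= -!big_split /=; apply: leq_sum => y; rewrite inE => x0y.
  apply: vertex_weight_slack => //.
  - by have := deg_adj x0y; lia.
  - exact: deg_leq.
  - exact/vertex_weight_le/deg_leq.
  - by move: kK_lt; lia.
have H3 : n * d * F <= n * d * S + d * (K * 2 ^ L.+1 * c1) * F.
  have : n * d * F <= n * d * (S + K * 2 ^ L.+1 * n ^ L.+3) by rewrite leq_mul2l H1 orbT.
  move: F_big; rewrite [n ^ _]expnS; move: (n ^ L.+3) => N HN.
  have : d * (K * 2 ^ L.+1) * (n * N) <= d * (K * 2 ^ L.+1) * (c1 * F).
    by rewrite leq_mul2l HN orbT.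
  lia.
rewrite -(leq_pmul2l F_gt0) /gap; lia.
Qed.

(** A vertex of [Y] has at most [K] neighbours in [Y], all being common neighbours with [x0]; so its
    degree and its missing pairs sum to at most [x + K]. *)
Lemma structure_missing : \sum_(y in Y) #|X :\: nbh y| <= miss * n.
Proof.
have H : \sum_(y in Y) #|X :\: nbh y| + \sum_(y in Y) deg y <= d * (x + K).
  rewrite -big_split /= d_sum; apply: leq_sum => y; rewrite inE => x0y.
  have H1 := cardsID (nbh y) X; have H2 := cardsID X (nbh y).
  rewrite [nbh y :&: X]setIC in H2.
  have H3 : #|nbh y :\: X| <= K.
    apply: leq_trans (codeg x0y); apply/subset_leq_card/subsetP => z.
    by rewrite !inE negbK.
  have H4 : deg y = #|nbh y| by [].
  by move: H1 H2; rewrite card_X H4; lia.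
have Hd : miss * d <= miss * n by rewrite leq_mul2l d_le orbT.
by have := structure_slack; move: Hd H; rewrite /miss; lia.
Qed.

(** For neighbours [y] in [Y] and [z] in [X] of [v], either [z] is one of the at most [K] common
    neighbours of [v] and [y], or [yz] is a missing pair. *)
Lemma structure_product v : #|nbh v :&: Y| * #|nbh v :&: X| <= (miss + K) * n.
Proof.
have H : #|nbh v :&: Y| * #|nbh v :&: X| <= #|nbh v :&: Y| * K + \sum_(y in Y) #|X :\: nbh y|.
  have S : \sum_(y in nbh v :&: Y) #|X :\: nbh y| <= \sum_(y in Y) #|X :\: nbh y|.
    by rewrite [leqRHS](big_setID (nbh v)) /= setIC leq_addr.
  apply: leq_trans (leq_add (leqnn _) S); rewrite -!sum_nat_const.
  rewrite -big_split /=; apply: leq_sum => y; rewrite !inE => /andP[vy _].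
  apply: leq_trans (leq_add (codeg vy) (leqnn _)).
  apply: leq_trans (leq_card_setU _ _); apply/subset_leq_card/subsetP => z.
  by rewrite !inE => /andP[-> ->]; rewrite !andbT orbN.
have Hp : #|nbh v :&: Y| * K <= n * K by rewrite leq_mul2r max_card orbT.
by have := structure_missing; move: H Hp; lia.
Qed.

Let deg_split v : deg v = #|nbh v :&: Y| + #|nbh v :&: X|.
Proof. by have := cardsID Y (nbh v); rewrite setDE => ->. Qed.

(** The larger of the two numbers is at least $n/2k$, so the product bound makes the smaller one
    bounded. *)
Lemma structure_few v : #|nbh v :&: Y| <= few \/ #|nbh v :&: X| <= few.
Proof.
have := structure_product v; have := mindeg v; rewrite deg_split.
move: #|_ :&: Y| #|_ :&: X| => p q np.
have fewE m : p + q <= 2 * m -> (miss + K) * n <= few * m.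
  move=> pqm; have : k * (p + q) <= k * (2 * m) by rewrite leq_mul2l pqm orbT.
  move=> /(leq_trans np) => H.
  by apply: leq_trans (leq_mul (leqnn _) H) _; rewrite /few; lia.
have [le_qp|lt_pq] := leqP q p => pq; [right|left].
  have p0 : 0 < p by move: n_gt0 np; case: p le_qp {pq fewE} => //; case: q => //; lia.
  by rewrite -(leq_pmul2l p0) [p * few]mulnC (leq_trans pq) ?fewE //; lia.
have q0 : 0 < q by lia.
by rewrite -(leq_pmul2r q0) (leq_trans pq) ?fewE //; lia.
Qed.

(** [U] and [W] are the star sums at a vertex of [X] and of [Y] if all pairs between [X] and [Y],
    and no others, are edges. *)
Let U := d * psi d x.
Let W := x * psi x d.

Let D_le v : D <= \sum_(y in nbh v) psi (deg v) (deg y).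
Proof. exact: leq_trans (D_at v) (leq_bicliques_at rsym _ _ v). Qed.

Let n_pow m : n * (m * n ^ L.+1) = m * n ^ L.+2.
Proof. by rewrite [n ^ L.+2]expnS; lia. Qed.

Let x_le : x <= n. Proof. exact: leq_subr. Qed.
Let K_le : K <= n. Proof. exact: leq_trans K_few (ltnW few_lt). Qed.

(** Summed over all vertices of $K_{x,d}$, the star sums count each biclique $a+b$ times, up to the
    scaling by $ab$. *)
Lemma structure_sum : x * U + d * W <= h * F.
Proof.
have -> : x * U + d * W = x * d * (psi d x + psi x d) by rewrite /U /W; lia.
rewrite star_weight_sym mulnCA leq_mul2l; apply/orP; right.
apply: leq_trans (vertex_weight_le al.+1 be.+1 d_le).
by rewrite /vertex_weight -/x; lia.
Qed.

(** The star at [x0] has degree exactly [d], and its leaves have degree at most [x + K]. *)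
Lemma structure_U_lower : D <= U + c8 * n ^ L.+2.
Proof.
apply: leq_trans (D_le x0) _; apply: leq_trans (_ : \sum_(y in Y) psi d (x + K) <= _).
  apply: leq_sum => y; rewrite inE => x0y; apply: star_weight_mono => //.
  by have := deg_adj x0y; move: dx; rewrite -/d; lia.
rewrite sum_nat_const -/d.
apply: leq_trans (leq_mul (leqnn d) (star_weight_shift al be d_le x_le K_le)) _.
rewrite mulnDr leq_add2l; apply: leq_trans (leq_mul d_le (leqnn _)) _.
by rewrite n_pow leq_mul2r /c8 leq_addr orbT.
Qed.

(** Any neighbour of [x0] serves as centre: its degree is at most [x + K], and its neighbours have
    degree at most [d]. *)
Lemma structure_W_lower : D <= W + c8 * n ^ L.+2.
Proof.
have /card_gt0P[y] : 0 < #|Y| by exact: d_gt0.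
rewrite inE => x0y; apply: leq_trans (D_le y) _.
have dy : deg y <= x + K by have := deg_adj x0y; move: dx; rewrite -/d; lia.
apply: leq_trans (_ : \sum_(z in nbh y) psi (deg y) d <= _).
  by apply: leq_sum => z _; apply: star_weight_mono.
rewrite sum_nat_const.
have H1 : psi (deg y) d <= psi x d + shift K * n ^ L.+1.
  apply: leq_trans (star_weight_shift_l al be x_le d_le K_le).
  exact: star_weight_mono.
have H2 : psi (deg y) d <= h * n ^ L.+2 by apply: leq_star_weight => //; apply: deg_leq.
apply: leq_trans (leq_mul dy (leqnn _)) _; rewrite mulnDl.
apply: leq_trans (leq_add (leq_mul (leqnn x) H1) (leq_mul (leqnn K) H2)) _.
have -> : c8 * n ^ L.+2 = shift K * n ^ L.+2 + K * (h * n ^ L.+2).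
  by rewrite [c8 * _]mulnDl [K * (_ * _)]mulnA.
by rewrite mulnDr -addnA leq_add2l leq_add2r -n_pow leq_mul2r x_le orbT.
Qed.

(** The average of [U] and [W] with weights [x] and [d] is at most [D] up to lower order, and
    neither is much below [D]. Both weights are linear in [n], so neither is much above [D]. *)
Lemma structure_upper : U <= D + c9 * n ^ L.+2 /\ W <= D + c9 * n ^ L.+2.
Proof.
have := structure_sum; have := structure_U_lower; have := structure_W_lower.
move: F_D; rewrite [n ^ L.+3]expnS; move: (n ^ L.+2) => N HF HW HU HS.
have HUW : x * U + d * W <= n * D + c6 * (n * N) by apply: leq_trans HS HF.
have HdW : d * D <= d * (W + c8 * N) by rewrite leq_mul2l HW orbT.
have HxU : x * D <= x * (U + c8 * N) by rewrite leq_mul2l HU orbT.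
have HnD : n * D = d * D + x * D by rewrite -dx mulnDl.
have Hd8 : d * (c8 * N) <= n * (c8 * N) by rewrite leq_mul2r d_le orbT.
have Hx8 : x * (c8 * N) <= n * (c8 * N) by rewrite leq_mul2r x_le orbT.
have Hnx : n * ((c6 + c8) * N) <= 2 * k * x * ((c6 + c8) * N) by rewrite leq_mul2r n_kx orbT.
have n_kd2 : n <= 2 * k * d by move: n_kd; lia.
have Hnd : n * ((c6 + c8) * N) <= 2 * k * d * ((c6 + c8) * N) by rewrite leq_mul2r n_kd2 orbT.
have x_gt0 : 0 < x by move: n_kx n_gt0; case: x; rewrite ?muln0; lia.
split; [rewrite -(leq_pmul2l x_gt0) | rewrite -(leq_pmul2l d_gt0)]; rewrite /c9; lia.
Qed.

Let absurd_D : 3 * D <= 2 * D + c10 * n ^ L.+2 -> False.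
Proof.
move=> H; have {H} : D <= c10 * n ^ L.+2 by lia.
move: D_big; rewrite [n ^ L.+3]expnS => H1 H2.
have N0 : 0 < n ^ L.+2 by rewrite expn_gt0 n_gt0.
have : n * n ^ L.+2 <= c2 * c10 * n ^ L.+2.
  by apply: leq_trans H1 _; rewrite -mulnA leq_mul2l H2 orbT.
by rewrite leq_pmul2r // leqNgt c10_lt.
Qed.

(** Otherwise the star sum at [v], which is at least [D], would be at most two thirds of [U] or [W]
    up to lower order, hence about $2D/3$. *)
Lemma structure_type v :
  2 * d < 3 * #|nbh v :&: Y| \/ 2 * x < 3 * #|nbh v :&: X|.
Proof.
have [HU HW] := structure_upper.
have Dv := D_le v; have dv := deg_split v.
have split_sum (w : T -> nat) :
    \sum_(y in nbh v) w y = \sum_(y in nbh v :&: Y) w y + \sum_(y in nbh v :&: X) w y.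
  by rewrite (big_setID Y) /= setDE.
set p := #|nbh v :&: Y| in dv *; set q := #|nbh v :&: X| in dv *.
have p_le : p <= d by apply/subset_leq_card/subsetIr.
have [le_p|lt_p] := leqP (3 * p) (2 * d); last by left.
have [le_q|lt_q] := leqP (3 * q) (2 * x); last by right.
case: absurd_D; case: (structure_few v) => few_v.
(* With few neighbours in [Y], [v] behaves like a vertex of [Y] and is compared with [W]. *)
- have H : D <= (p + q) * psi (p + q) d.
    apply: leq_trans Dv _; rewrite -dv -sum_nat_const.
    by apply: leq_sum => z _; apply: star_weight_mono.
  have H1 : psi (p + q) d <= psi x d + shift few * n ^ L.+1.
    apply: leq_trans (star_weight_shift_l al be x_le d_le (ltnW few_lt)).
    by apply: star_weight_mono => //; move: few_v; rewrite -/p; lia.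
  have H2 : psi (p + q) d <= h * n ^ L.+2.
    by apply: leq_star_weight => //; rewrite -dv; apply: deg_leq.
  have H3 : q * (shift few * n ^ L.+1) <= shift few * n ^ L.+2.
    by rewrite -n_pow leq_mul2r; apply/orP; right; move: x_le; lia.
  have H4 : p * psi (p + q) d <= few * (h * n ^ L.+2) by apply: leq_mul.
  have H5 : q * psi (p + q) d <= q * psi x d + q * (shift few * n ^ L.+1).
    by rewrite -mulnDr leq_mul2l H1 orbT.
  have H6 : 3 * (q * psi x d) <= 2 * W.
    by rewrite /W !mulnA leq_mul2r le_q orbT.
  by move: H HW; rewrite mulnDl /c10; lia.
(* With few neighbours in [X], [v] behaves like a vertex of [X] and is compared with [U]. *)
- have H1 : \sum_(y in nbh v :&: Y) psi (deg v) (deg y) <= p * psi d x + shift K * n ^ L.+2.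
    apply: leq_trans (_ : \sum_(y in nbh v :&: Y) (psi d x + shift K * n ^ L.+1) <= _).
      apply: leq_sum => y; rewrite !inE => /andP[_ x0y].
      apply: leq_trans (star_weight_shift al be d_le x_le K_le).
      apply: star_weight_mono => //.
      by have := deg_adj x0y; move: dx; rewrite -/d; lia.
    rewrite sum_nat_const -/p mulnDr leq_add2l -n_pow leq_mul2r.
    by rewrite (leq_trans p_le d_le) orbT.
  have H2 : \sum_(y in nbh v :&: X) psi (deg v) (deg y) <= few * (h * n ^ L.+2).
    apply: leq_trans (_ : \sum_(y in nbh v :&: X) h * n ^ L.+2 <= _).
      by apply: leq_sum => y _; apply: leq_star_weight; apply: deg_leq.
    by rewrite sum_nat_const leq_mul2r few_v orbT.
  have H3 : 3 * (p * psi d x) <= 2 * U.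
    by rewrite /U !mulnA leq_mul2r le_p orbT.
  by move: Dv HU; rewrite split_sum /c10; lia.
Qed.

Lemma structure_triangle_free u v : r u v -> nbh u :&: nbh v = set0.
Proof.
move=> uv; apply/eqP; rewrite -subset0; apply/subsetP => w; rewrite !inE => /andP[uw vw].
have inter (Z : {set T}) y z : r y z ->
    #|nbh y :&: Z| + #|nbh z :&: Z| <= #|Z| + K.
  move=> /codeg H; rewrite -cardsUI leq_add //.
    by rewrite -setIUl subset_leq_card ?subsetIr.
  by apply: leq_trans H; rewrite setIACA setIid subset_leq_card ?subsetIl.
have nY y z : r y z -> 2 * d < 3 * #|nbh y :&: Y| -> 2 * d < 3 * #|nbh z :&: Y| -> False.
  move=> /(inter Y); rewrite -/d; have : #|Y| = d by []; move=> -> H H1 H2.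
  have : k * d <= k * (3 * K) by rewrite leq_mul2l; apply/orP; right; lia.
  by move: n_kd kK_lt; lia.
have nX y z : r y z -> 2 * x < 3 * #|nbh y :&: X| -> 2 * x < 3 * #|nbh z :&: X| -> False.
  move=> /(inter X); rewrite card_X => H H1 H2.
  have : k * x <= k * (3 * K) by rewrite leq_mul2l; apply/orP; right; lia.
  by move: n_kx kK_lt; lia.
(* Two vertices of a triangle are of the same kind; their neighbourhoods would share more than [K]
   vertices of one part. *)
case: (structure_type u) (structure_type v) (structure_type w) => Hu [] Hv [] Hw;
  solve [case: (nY _ _ uv Hu Hv) | case: (nX _ _ uv Hu Hv)
       | case: (nY _ _ uw Hu Hw) | case: (nX _ _ uw Hu Hw)
       | case: (nY _ _ vw Hv Hw) | case: (nX _ _ vw Hv Hw)].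
Qed.

End Structure.

(** * The bound for large graphs satisfying [plus_free] *)

Section PlusFreeBound.
Variables al be s : nat.
Hypothesis s_gt0 : 0 < s.
Local Notation a := al.+2.
Local Notation b := be.+2.
Local Notation h := (a + b).
Local Notation L := (al + be).

Lemma high_degree_triangle_free :
  exists n1, forall (T : finType) (r : rel T), symmetric r -> irreflexive r ->
    n1 < #|T| -> plus_free r s ->
    bip_max a b #|T| <= #|bicliques r a b| ->
    (forall v, bip_max a b #|T| <= bip_max a b #|T|.-1 + #|bicliques_at r a b v|) ->
  forall u v, r u v -> nbh r u :&: nbh r v = set0.
Proof.
(* [c1] is the constant of [bip_max_lower]; [c2] gives $n^{L+3} \le c_2 D$, its power of 2 passing
   from $n$ to $n-1$; [k] is the resulting constant for the minimum degree. *)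
pose c1 := 7 ^ h * (a`! * b`!); pose c2 := 2 ^ L.+3 * c1; pose k := c2 * h.
pose K := 2 * k * s.
exists (2 * h + K * 2 ^ K + structure_threshold al be k K c1 c2).
move=> T r rsym rirr n_big pf Qn Hv.
case def_n: #|T| n_big Qn Hv => [|m] //= n_big Qn Hv.
set M := bip_max a b in Qn Hv.
have M_mono : M m <= M m.+1.
  have := bip_max_step al be m; rewrite -/M => H.
  have m0 : 0 < m by lia.
  by rewrite -(leq_pmul2l m0) (leq_trans _ H) ?leq_addl.
pose D := M m.+1 - M m.
have DM : M m.+1 = M m + D by rewrite subnKC.
have hD : h * M m <= m * D by have := bip_max_step al be m; rewrite -/M DM; lia.
have hE : h = L.+4 by lia.
have m_pow : m ^ L.+4 <= c1 * M m.
  by have := @bip_max_lower al be m ltac:(lia); rewrite -/c1 hE.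
have n_pow : m.+1 ^ L.+4 <= c1 * M m.+1.
  by have := @bip_max_lower al be m.+1 ltac:(lia); rewrite -/c1 hE.
have D_pow : m.+1 ^ L.+3 <= c2 * D.
  apply: leq_trans (_ : (2 * m) ^ L.+3 <= _); first by apply: leq_pow2r; lia.
  rewrite expnMn /c2 -mulnA leq_mul2l; apply/orP; right.
  have m0 : 0 < m by lia.
  rewrite -(leq_pmul2l m0) -expnS (leq_trans m_pow) // mulnCA leq_mul2l.
  apply/orP; right; apply: leq_trans hD; exact: leq_pmull.
have hdeg v : D <= #|bicliques_at r a b v| by have := Hv v; rewrite DM leq_add2l.
have c1_gt0 : 0 < c1 by rewrite /c1 muln_gt0 expn_gt0 muln_gt0 !fact_gt0.
have c2_gt0 : 0 < c2 by rewrite /c2 muln_gt0 expn_gt0 c1_gt0.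
have k_gt0 : 0 < k by rewrite /k muln_gt0 c2_gt0.
(* An edge at [v] lies in at most order $n^{L+2}$ bicliques, while [v] lies in order $n^{L+3}$ of
   them. *)
have mindeg v : #|T| <= k * deg r v.
  have H : #|bicliques_at r a b v| <= deg r v * (h * #|T| ^ L.+2).
    apply: leq_trans (_ : a * b * #|bicliques_at r a b v| <= _); first by rewrite leq_pmull.
    apply: leq_trans (leq_bicliques_at rsym _ _ v) _.
    rewrite -sum_nat_const; apply: leq_sum => y _.
    exact: (leq_star_weight al be (deg_leq r v) (deg_leq r y)).
  have n0 : 0 < #|T| ^ L.+2 by rewrite expn_gt0 def_n.
  rewrite -(leq_pmul2r n0) -expnS [in leqLHS]def_n (leq_trans D_pow) //.
  apply: leq_trans (leq_mul (leqnn c2) (leq_trans (hdeg v) H)) _.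
  by rewrite /k; lia.
have codeg := codeg_plus_free rsym pf s_gt0 k_gt0 ltac:(rewrite -/K; lia) mindeg.
have [/card0_eq T0 u|/card_gt0P[x1 _]] := posnP #|T|; first by have := T0 u.
have [x0 x0max] := exists_max_deg r x1.
apply: (@structure_triangle_free al be k K c1 c2 T r rsym rirr (a * b * D)
          _ mindeg codeg _ _ _ _ _ x0 x0max); rewrite ?def_n //.
- by lia.
- by apply: leq_trans n_pow _; rewrite leq_mul2l leq_pmull ?orbT.
- by apply: leq_trans D_pow _; rewrite leq_mul2l leq_pmull ?orbT.
- have := bip_max_diff al be m; rewrite -/M => HM.
  have H1 : m ^ L.+3 <= m.+1 ^ L.+3 by apply: leq_pow2r.
  have H2 : h * M m.+1 <= m.+1 * D + 2 * h * m.+1 ^ L.+3.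
    move: H1 HM hD; move: (m ^ _) (m.+1 ^ _) => N N' H1 HM hD.
    have : h * M m.+1 <= h * (M m + 2 * N') by rewrite leq_mul2l; apply/orP; right; lia.
    lia.
  have := leq_mul (leqnn (a * b)) H2.
  by rewrite /scaled_max -/M; lia.
- by move=> v; rewrite leq_mul2l hdeg orbT.
Qed.

Lemma plus_free_del (T : finType) (r : rel T) (v : T) :
  plus_free r s -> plus_free (del_vertex r v) s.
Proof.
move=> pf A B x y cA cB H xA yA.
have := pf (val @: A) (val @: B) (val x) (val y).
rewrite !card_imset; [|exact: val_inj|exact: val_inj].
apply => //; try exact: imset_f.
by move=> _ _ /imsetP[x' x'A ->] /imsetP[y' y'B ->]; apply: H.
Qed.

(* Deleting a vertex in few bicliques increases the excess over the conjectured
   maximum; repeated too often, it would leave more bicliques than a graph on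
   n1 vertices can have. *)
Lemma bicliques_plus_free :
  exists n0, forall (T : finType) (r : rel T), symmetric r -> irreflexive r ->
    n0 <= #|T| -> plus_free r s -> #|bicliques r a b| <= bip_max a b #|T|.
Proof.
have [n1 Hn1] := high_degree_triangle_free.
pose B := 2 ^ n1 * 2 ^ n1.
(* The second alternative says that the excess on [n1 + j] vertices is at most [B - j]; for [j] at
   least [B] it gives the bound as well. *)
have key j (T : finType) (r : rel T) : symmetric r -> irreflexive r ->
    #|T| = n1 + j -> plus_free r s ->
    #|bicliques r a b| <= bip_max a b #|T| \/
    #|bicliques r a b| + j <= bip_max a b #|T| + B.
  elim: j T r => [|j IH] T r rsym rirr cT pf.
    right; rewrite addn0; rewrite addn0 in cT; apply: leq_trans (leq_bicliques_exp r a b) _.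
    by rewrite cT leq_addl.
  have [le_Q|lt_Q] := leqP #|bicliques r a b| (bip_max a b #|T|); first by left.
  right.
  have [/forallP Hv|/forallPn[v]] := boolP [forall v,
      bip_max a b #|T| <= bip_max a b #|T|.-1 + #|bicliques_at r a b v|].
    have tf := Hn1 T r rsym rirr ltac:(lia) pf (ltnW lt_Q) Hv.
    by move: lt_Q; rewrite ltnNge bicliques_triangle_free.
  rewrite -ltnNge => Hv; have Hdel := leq_bicliques_del r v a b.
  have rsym' : symmetric (del_vertex r v) by move=> x y; apply: rsym.
  have rirr' : irreflexive (del_vertex r v) by move=> x; apply: rirr.
  have cT' : #|{: {x : T | x != v}}| = n1 + j by rewrite card_del_vertex cT addnS.
  have := IH _ (del_vertex r v) rsym' rirr' cT' (plus_free_del pf).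
  by rewrite card_del_vertex => -[]; lia.
exists (n1 + B) => T r rsym rirr cT pf.
by have [] := key (#|T| - n1) T r rsym rirr ltac:(lia) pf; lia.
Qed.
End PlusFreeBound.

(** * Copies of complete bipartite graphs *)

Lemma adj_sym (T : finType) (G : sgraph T) : symmetric (adj G).
Proof. by move=> x y; rewrite /adj setUC. Qed.

Lemma adj_irr (T : finType) (G : sgraph T) : irreflexive (adj G).
Proof. by move=> x; apply: contraTF isT => /adj_neq; rewrite eqxx. Qed.

Lemma set2_eq (T : finType) (x y u v : T) :
  [set x; y] = [set u; v] -> (x = u /\ y = v) \/ (x = v /\ y = u).
Proof.
move=> E; have Hx : x \in [set u; v] by rewrite -E set21.
have Hy : y \in [set u; v] by rewrite -E set22.
have Hu : u \in [set x; y] by rewrite E set21.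
have Hv : v \in [set x; y] by rewrite E set22.
case/set2P: Hx => ?; case/set2P: Hy => ?; subst; auto.
- by case/set2P: Hv => ->; auto.
- by case/set2P: Hu => ->; auto.
Qed.

Lemma adj_graph_of_rel (T : finType) (r : rel T) x y :
  adj (graph_of_rel r) x y = (x != y) && (r x y || r y x).
Proof.
apply/imset2P/andP => [[u v _ ]|[xy /orP[]H]].
- rewrite inE => /and3P[_ uv ruv] /set2_eq[][-> ->]; first by rewrite uv ruv.
  by rewrite eq_sym uv ruv orbT.
- by exists x y => //; rewrite inE xy.
by exists y x; rewrite ?inE // 1?eq_sym ?xy // setUC.
Qed.

Lemma edgeP (T : finType) (G : sgraph T) e :
  e \in edges G -> exists x y, e = [set x; y] /\ adj G x y.
Proof.
move=> eG; have /cards2P[x [y [_ E]]] := forall_inP (edges_card2 G) e eG.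
by exists x, y; split; rewrite // /adj -E.
Qed.

Lemma embedding_not_free (U T : finType) (H : sgraph U) (G : sgraph T) (f : U -> T) :
  injective f -> (forall x y, adj H x y -> adj G (f x) (f y)) -> ~~ graph_free H G.
Proof.
move=> f_inj fH; apply/set0Pn.
exists (f @: [set: U], [set [set f p.1; f p.2] | p in [set p | adj H p.1 p.2]]).
rewrite inE; apply/andP; split.
  apply/andP; split=> /=.
    by apply/subsetP => _ /imsetP[p + ->]; rewrite inE => /fH.
  apply/forall_inP => _ /imsetP[p _ ->].
  by rewrite subUset !sub1set !imset_f ?inE.
apply/existsP; exists [ffun x => f x]; apply/and3P; split => /=.
- by apply/injectiveP => x y; rewrite !ffunE => /f_inj.
- by apply/eqP/eq_imset => x; rewrite ffunE.
apply/forallP => x; apply/forallP => y; rewrite !ffunE; apply/eqP.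
apply/idP/imsetP => [xy|[[u v]]]; first by exists (x, y); rewrite ?inE.
by rewrite inE /= => uv /set2_eq[][/f_inj-> /f_inj->] //; rewrite adj_sym.
Qed.

Lemma not_free_hom (U T : finType) (H : sgraph U) (G : sgraph T) :
  ~~ graph_free H G -> exists f : U -> T, forall x y, adj H x y -> adj G (f x) (f y).
Proof.
case/set0Pn => S; rewrite inE => /andP[/andP[/subsetP SG _] /existsP[f /and3P[_ _ /forallP fH]]].
exists f => x y xy; apply: SG; have /forallP/(_ y) := fH x.
by rewrite xy => /eqP <-.
Qed.

Section BicliqueCopies.
Variables (T : finType) (G : sgraph T) (a b : nat).
Hypothesis a_gt0 : 0 < a.

Definition biclique_graph (P : {set T} * {set T}) : {set T} * {set {set T}} :=
  (P.1 :|: P.2, [set [set x; y] | x in P.1, y in P.2]).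

Lemma biclique_graph_edge P x y :
  ([set x; y] \in (biclique_graph P).2) =
  ((x \in P.1) && (y \in P.2)) || ((y \in P.1) && (x \in P.2)).
Proof.
apply/imset2P/orP => [[u v uA vB /set2_eq[][-> ->]]|[]/andP[xA yB]].
- by left; rewrite uA vB.
- by right; rewrite uA vB.
- by exists x y.
by exists y x; rewrite // setUC.
Qed.

Lemma biclique_disjoint P : P \in bicliques (adj G) a b -> [disjoint P.1 & P.2].
Proof.
case/bicliquesP => _ _ H; apply/pred0P => x /=; apply/negP => /andP[xA xB].
by have := H x x xA xB; rewrite adj_irr.
Qed.

Lemma copies_biclique :
  copies (complete_bipartite a b) G = biclique_graph @: bicliques (adj G) a b.
Proof.
apply/setP => -[S E]; apply/idP/imsetP; rewrite inE.
  case/andP=> /andP[/= /subsetP EG /forall_inP ES] /existsP[f /and3P[/injectiveP f_inj /eqP /= fS fE]].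
  have {}fE x y : adj (complete_bipartite a b) x y = ([set f x; f y] \in E).
    by have /forallP/(_ x)/forallP/(_ y)/eqP := fE.
  exists ([set f (inl i) | i : 'I_a], [set f (inr i) | i : 'I_b]).
    apply/bicliquesP; split=> /=.
    - by rewrite card_imset ?card_ord // => i j /f_inj[].
    - by rewrite card_imset ?card_ord // => i j /f_inj[].
    move=> _ _ /imsetP[i _ ->] /imsetP[j _ ->]; apply: EG.
    by rewrite -fE adj_graph_of_rel.
  have fA i : f (inl i) \in [set f (inl i) | i : 'I_a] by apply/imsetP; exists i.
  have fB i : f (inr i) \in [set f (inr i) | i : 'I_b] by apply/imsetP; exists i.
  congr pair; rewrite /= -?fS.
    apply/setP => x; rewrite !inE; apply/imsetP/orP => [[[i|i] _ ->]|[]/imsetP[i _ ->]].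
    - by left.
    - by right.
    - by exists (inl i); rewrite ?inE.
    - by exists (inr i); rewrite ?inE.
  apply/setP => e; apply/idP/imset2P.
    move=> eE; have [x [y [def_e _]]] := edgeP (EG _ eE).
    have := ES _ eE; rewrite def_e subUset !sub1set -fS => /andP[/imsetP[u _ def_x] /imsetP[v _ def_y]].
    move: eE; rewrite def_e def_x def_y -fE adj_graph_of_rel => /andP[_].
    case: u v {def_x def_y} => i [] j //= _.
      by exists (f (inl i)) (f (inr j)).
    by exists (f (inl j)) (f (inr i)); rewrite // setUC.
  case=> _ _ /imsetP[i _ ->] /imsetP[j _ ->] ->.
  by rewrite -fE adj_graph_of_rel.
case=> -[A B] PB [-> ->]; have dAB := biclique_disjoint PB.
case/bicliquesP: (PB) => /= cA cB HAB; apply/andP; split.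
  apply/andP; split=> /=.
    by apply/subsetP => _ /imset2P[x y xA yB ->]; apply: HAB.
  apply/forall_inP => _ /imset2P[x y xA yB ->].
  by rewrite subUset !sub1set !inE xA yB orbT.
pose f (z : 'I_a + 'I_b) := match z with
  | inl i => enum_val (cast_ord (esym cA) i)
  | inr i => enum_val (cast_ord (esym cB) i) end.
have fA i : f (inl i) \in A by apply: enum_valP.
have fB i : f (inr i) \in B by apply: enum_valP.
apply/existsP; exists [ffun z => f z]; apply/and3P; split => /=.
- apply/injectiveP => -[i|i] [j|j]; rewrite !ffunE.
  + by move/enum_val_inj/cast_ord_inj => ->.
  + by move=> E'; have := disjointFr dAB (fA i); rewrite E' fB.
  + by move=> E'; have := disjointFr dAB (fA j); rewrite -E' fB.
  + by move/enum_val_inj/cast_ord_inj => ->.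
- apply/eqP/setP => x; apply/imsetP/setUP => [[[i|i] _ ->]|[xA|xB]]; rewrite ?ffunE ?fA ?fB; auto.
  + exists (inl (cast_ord cA (enum_rank_in xA x))); rewrite ?inE //.
    by rewrite ffunE /= cast_ordK enum_rankK_in.
  + exists (inr (cast_ord cB (enum_rank_in xB x))); rewrite ?inE //.
    by rewrite ffunE /= cast_ordK enum_rankK_in.
apply/forallP => u; apply/forallP => v; rewrite !ffunE; apply/eqP.
rewrite adj_graph_of_rel (biclique_graph_edge (A, B)) /=.
have fA' i : f (inl i) \in B = false by apply: (disjointFr dAB).
have fB' i : f (inr i) \in A = false by apply: (disjointFl dAB).
by case: u v => i [] j; rewrite ?fA ?fB ?fA' ?fB' ?andbF //=.
Qed.

(** In the common subgraph, a vertex of the first side of [P] has the second side as its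
    neighbourhood. Its position in [P'] decides whether the sides agree or are swapped. *)
Lemma biclique_graph_inj P P' :
    P \in bicliques (adj G) a b -> P' \in bicliques (adj G) a b ->
  biclique_graph P = biclique_graph P' -> P = P' \/ (a = b /\ P = (P'.2, P'.1)).
Proof.
move=> PB PB' E.
have dAB := biclique_disjoint PB; have dAB' := biclique_disjoint PB'.
have Eq x y := biclique_graph_edge P x y; rewrite E in Eq.
have {}Eq x y := etrans (esym (Eq x y)) (biclique_graph_edge P' x y).
have EU : P.1 :|: P.2 = P'.1 :|: P'.2 by case: E.
case/bicliquesP: PB PB' => cA cB _ /bicliquesP[cA' cB' _].
case: P P' dAB dAB' Eq EU cA cB cA' cB' {E} => [A B] [A' B'] /= dAB dAB' Eq EU cA cB cA' cB'.
have [x xA] : exists x, x \in A by apply/card_gt0P; rewrite cA.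
have xB : x \in B = false by apply: (disjointFr dAB).
have : x \in A' :|: B' by rewrite -EU inE xA.
have UD (C D : {set T}) : [disjoint C & D] -> C = (C :|: D) :\: D.
  by move=> /setDidPl dCD; rewrite setDUl setDv setU0.
case/setUP => [xA'|xB'].
  have xB' : x \in B' = false by apply: (disjointFr dAB').
  have EB : B = B'.
    by apply/setP => y; have := Eq x y; rewrite xA xB xA' xB' !andbF !orbF.
  by left; rewrite (UD A B) // (UD A' B') // EU EB.
have xA' : x \in A' = false by apply: (disjointFl dAB').
have EB : B = A'.
  by apply/setP => y; have := Eq x y; rewrite xA xB xA' xB' !andbF !orbF andbT.
have EA : A = B'.
  by rewrite (UD A B) // EU EB setUC -UD // disjoint_sym.
by right; split; [rewrite -cA EA | rewrite EA EB].
Qed.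

(** The fibres of [biclique_graph] are single pairs if [a] and [b] differ, and consist of a pair and
    its swap if they are equal. *)
Lemma ncopies_complete_bipartite :
  (1 + (a == b)) * ncopies (complete_bipartite a b) G = #|bicliques (adj G) a b|.
Proof.
rewrite /ncopies copies_biclique.
rewrite -[RHS]sum1_card (partition_big_imset biclique_graph) /= mulnC -sum_nat_const.
apply: eq_bigr => S /imsetP[P PB ->]; rewrite sum1dep_card.
have [def_b|neq_ab] := eqVneq a b.
  rewrite (_ : [set _ | _] = [set P; (P.2, P.1)]).
    rewrite cards2; case: eqP => // E.
    have := biclique_disjoint PB; rewrite {1}E /= -setI_eq0 setIid => /eqP P20.
    by case/bicliquesP: PB => _; rewrite P20 cards0; lia.
  apply/setP => P'; rewrite in_set in_set2; apply/andP/orP => [[PB' /eqP E]|].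
    by have [->|[_ ->]] := biclique_graph_inj PB' PB E; rewrite eqxx; auto.
  case=> /eqP ->; first by rewrite PB.
  split.
    case/bicliquesP: PB => cA cB H; apply/bicliquesP.
    by split=> [||x y xA yB] /=; rewrite ?cA ?cB // adj_sym H.
  apply/eqP; rewrite /biclique_graph /= setUC; congr pair.
  apply/setP => e; apply/imset2P/imset2P => -[x y xA yB ->].
    by exists y x; rewrite // setUC.
  by exists y x; rewrite // setUC.
rewrite (_ : [set _ | _] = [set P]) ?cards1 //.
apply/setP => P'; rewrite in_set in_set1; apply/andP/eqP => [[PB' /eqP E]|->]; last by [].
by have [->|[E']] := biclique_graph_inj PB' PB E; rewrite // E' eqxx in neq_ab.
Qed.
End BicliqueCopies.

(** * Colourings and forbidden subgraphs *)

Lemma colorableP (T : finType) (G : sgraph T) k :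
  reflect (exists c : T -> 'I_k, forall x y, adj G x y -> c x != c y) (colorable G k).
Proof.
apply: (iffP existsP) => [[c /forallP H]|[c H]].
  by exists c => x y; have /forallP/(_ y)/implyP := H x.
exists [ffun x => c x]; apply/forallP => x; apply/forallP => y.
by apply/implyP; rewrite !ffunE; apply: H.
Qed.

Lemma colorable_mono (T : finType) (G : sgraph T) k k' :
  k <= k' -> colorable G k -> colorable G k'.
Proof.
move=> kk' /colorableP[c H]; apply/colorableP; exists (fun x => widen_ord kk' (c x)).
by move=> x y /H; apply: contraNneq => /(congr1 val) /= /val_inj ->.
Qed.

Lemma colorable_chromatic (T : finType) (G : sgraph T) k :
  colorable G k = (chromatic_number G <= k).
Proof.
rewrite /chromatic_number; case: ex_minnP => m Hm min_m.
by apply/idP/idP => [/min_m|/colorable_mono]; last apply.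
Qed.

Lemma ord2_neq (i j l : 'I_2) : i != j -> l != j -> i = l.
Proof.
case: i j l => [[|[|//]] ?] [[|[|//]] ?] [[|[|//]] ?] //= _ _; exact: val_inj.
Qed.

Lemma bipartite_free (U T : finType) (H : sgraph U) (G : sgraph T) :
  ~~ colorable H 2 -> colorable G 2 -> graph_free H G.
Proof.
move=> nH /colorableP[c Hc]; apply: contraR nH => /not_free_hom[f Hf].
by apply/colorableP; exists (c \o f) => x y /Hf/Hc.
Qed.

Lemma bipartite_triangle_free (T : finType) (G : sgraph T) u v :
  colorable G 2 -> adj G u v -> nbh (adj G) u :&: nbh (adj G) v = set0.
Proof.
move=> /colorableP[c Hc] uv; apply/eqP; rewrite -subset0; apply/subsetP => w.
rewrite !inE => /andP[/Hc uw /Hc vw]; have := Hc _ _ uv.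
by rewrite (ord2_neq uw vw) eqxx.
Qed.

Lemma triangle_not_colorable : ~~ colorable (complete_graph 3) 2.
Proof.
apply/colorableP => -[c Hc]; suff /leq_card : injective c by rewrite !card_ord.
move=> x y Exy; apply/eqP; apply: contraTT (isT) => xy.
have := Hc x y; rewrite adj_graph_of_rel xy Exy eqxx /= => H.
by have := H isT.
Qed.

Lemma triangle_free_nbh (T : finType) (G : sgraph T) u v :
  graph_free (complete_graph 3) G -> adj G u v ->
  nbh (adj G) u :&: nbh (adj G) v = set0.
Proof.
move=> Gfree uv; apply/eqP; apply: contraLR Gfree => /set0Pn[w].
rewrite !inE => /andP[uw vw].
have E := (adj_sym G v u, adj_sym G w u, adj_sym G w v).
pose f (i : 'I_3) := nth u [:: u; v; w] i.
have fE i j : i != j -> adj G (f i) (f j).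
  by case: i j => [[|[|[|//]]] ?] [[|[|[|//]]] ?] //= _; rewrite /f /= ?E ?uv ?uw ?vw.
apply: (@embedding_not_free _ _ _ _ f) => [i j Eij|i j].
  by apply: contraTeq isT => /fE; rewrite Eij adj_irr.
by rewrite adj_graph_of_rel => /andP[ij _]; apply: fE.
Qed.

(** An arbitrary injection is followed by two transpositions inside [A], the first sending the image
    of [x] to [u], the second that of [y] to [v] while fixing [u]. *)
Lemma injection_into (V T : finType) (A : {set T}) (x y : V) (u v : T) :
    #|V| <= #|A| -> u \in A -> v \in A -> x != y -> u != v ->
  exists g : V -> T, [/\ injective g, forall z, g z \in A, g x = u & g y = v].
Proof.
move=> cVA uA vA xy uv.
pose g0 z := enum_val (widen_ord cVA (enum_rank z)).
have g0_inj : injective g0.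
  by move=> z z' /enum_val_inj/(congr1 val)/= /val_inj/enum_rank_inj.
have g0A z : g0 z \in A by apply: enum_valP.
pose g1 z := tperm (g0 x) u (g0 z).
have tA w w' z : w \in A -> w' \in A -> z \in A -> tperm w w' z \in A.
  by move=> *; case: tpermP.
exists (fun z => tperm (g1 y) v (g1 z)); split.
- by move=> z z' /perm_inj/perm_inj/g0_inj.
- by move=> z; rewrite !tA.
- rewrite /g1 tpermL tpermD //; last by rewrite eq_sym.
  rewrite -{2}(tpermL (g0 x) u) (inj_eq perm_inj) (inj_eq g0_inj) eq_sym //.
- by rewrite tpermL.
Qed.

(* Removing the critical edge leaves a bipartite graph, in which the two ends of
   that edge lie on the same side. *)
Lemma free_plus_free (V T : finType) (F : sgraph V) (G : sgraph T) :
    chromatic_number F = 3 -> (exists e, color_critical F e) ->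
  graph_free F G -> plus_free (adj G) #|V|.
Proof.
move=> chi [e /andP[eF]]; rewrite chi ltnS -colorable_chromatic => /colorableP[c Hc].
have [x0 [y0 [def_e x0y0]]] := edgeP eF.
have cE x y : adj F x y -> [set x; y] <> e -> c x != c y.
  by move=> xy ne; apply: Hc; apply/setD1P; split; first exact/eqP.
(* Otherwise [c] would be a proper 2-colouring of [F] itself. *)
have c_eq : c x0 = c y0.
  apply/eqP; apply: contraT => c_neq.
  have : colorable F 2; last by rewrite colorable_chromatic chi.
  apply/colorableP; exists c => x y xy.
  have [E|] := eqVneq [set x; y] e; last by move/eqP; apply: cE.
  by move: E; rewrite def_e => /set2_eq[][-> ->]; rewrite // eq_sym.
move=> Gfree A B u v cA cB H uA vA; apply/negP => uv; move: Gfree.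
(* The colour class of [x0] and [y0] goes into [A] by [g], with the critical edge sent to [uv]; the
   other class goes into [B] by [g']. *)
have [g [g_inj gA gx gy]] := injection_into cA uA vA (adj_neq x0y0) (adj_neq uv).
pose g' z := enum_val (widen_ord cB (enum_rank z)).
have g'_inj : injective g'.
  by move=> z z' /enum_val_inj/(congr1 val)/= /val_inj/enum_rank_inj.
have g'B z : g' z \in B by apply: enum_valP.
have gg' z z' : g z <> g' z'.
  by move=> E; have := H _ _ (gA z) (g'B z'); rewrite E adj_irr.
pose f z := if c z == c x0 then g z else g' z.
apply/negP; apply: (@embedding_not_free _ _ _ _ f).
  move=> z z'; rewrite /f; case: ifP => _; case: ifP => _.
  - exact: g_inj.
  - by move/gg'.
  - by move/esym/gg'.
  - exact: g'_inj.
move=> x y xy; have [E|/eqP ne] := eqVneq [set x; y] e.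
  move: E; rewrite def_e => /set2_eq[][-> ->]; rewrite /f c_eq eqxx gx gy //.
  by rewrite adj_sym.
have cxy := cE _ _ xy ne; rewrite /f; case: eqP => [cx|/eqP cx]; case: eqP => [cy|/eqP cy].
- by move: cxy; rewrite cx cy eqxx.
- exact: H.
- by rewrite adj_sym; apply: H.
- by move: cxy; rewrite (ord2_neq cx cy) eqxx.
Qed.

Theorem theorem1p9 (V : finType) (F : sgraph V) (a b : nat)
    (hchi : chromatic_number F = 3)
    (hcrit : exists e : {set V}, color_critical F e)
    (ha : 2 <= a) (hb : 2 <= b) :
  exists n0 : nat, forall n : nat, n0 <= n ->
    exists t : nat,
      [/\ t <= n,
          turan_ex n (complete_bipartite a b) F
            = turan_ex n (complete_bipartite a b) (complete_graph 3)
        & turan_ex n (complete_bipartite a b) (complete_graph 3)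
            = ncopies (complete_bipartite a b) (complete_bipartite t (n - t))].
Proof.
have V_gt0 : 0 < #|V|.
  have [e /andP[/edgeP[x _] _]] := hcrit; apply/card_gt0P.
  by exists x.
case: a ha => [|[|al]] // _; case: b hb => [|[|be]] // _.
have [n0 Hn0] := bicliques_plus_free al be V_gt0.
exists n0 => n n0n; have [t tn def_max] := bip_max_attained al.+2 be.+2 n.
set H := complete_bipartite al.+2 be.+2.
set M := bip_max _ _ _ in def_max.
set N := ncopies H (complete_bipartite t (n - t)).
have copiesE (T : finType) (G : sgraph T) :
    (1 + (al.+2 == be.+2)) * ncopies H G = #|bicliques (adj G) al.+2 be.+2|.
  exact: ncopies_complete_bipartite.
have triangle_free_max (T : finType) (G : sgraph T) : #|T| = n ->
    (forall u v, adj G u v -> nbh (adj G) u :&: nbh (adj G) v = set0) ->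
    #|bicliques (adj G) al.+2 be.+2| <= M.
  by move=> cT tf; rewrite /M -cT; apply: bicliques_triangle_free => //; [apply: adj_sym | apply: adj_irr].
have N_max : (1 + (al.+2 == be.+2)) * N = M.
  rewrite copiesE; apply/eqP; rewrite eqn_leq triangle_free_max.
  - rewrite def_max.
    apply: (@bip_count_leq_bicliques _ _ [set inl i | i : 'I_t] [set inr i | i : 'I_(n - t)]) => //.
    + by rewrite card_imset ?card_ord //; apply: inl_inj.
    + by rewrite card_imset ?card_ord //; apply: inr_inj.
    + by apply/pred0P => x; apply/negP => /andP[/imsetP[i _ ->] /imsetP[]].
    + exact: adj_sym.
    by move=> _ _ /imsetP[i _ ->] /imsetP[j _ ->]; rewrite adj_graph_of_rel.
  - by rewrite card_sum !card_ord subnKC.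
  move=> u v; apply: bipartite_triangle_free; apply/colorableP.
  exists (fun x => if x is inl _ then ord0 else ord_max) => -[i|i] [j|j];
    by rewrite adj_graph_of_rel ?andbF.
(* [turan_ex] ranges over graphs on ['I_n], so $K_{t,n-t}$ is rebuilt there. *)
pose B := graph_of_rel (fun i j : 'I_n => (i < t) && (t <= j)).
have B_bip : colorable B 2.
  apply/colorableP; exists (fun i : 'I_n => if i < t then ord0 else ord_max) => i j.
  rewrite adj_graph_of_rel; have [it|it] := ltnP i t; have [jt|jt] := ltnP j t => //;
    by rewrite ?andbF //; lia.
have NB : N <= ncopies H B.
  rewrite -(@leq_pmul2l (1 + (al.+2 == be.+2))) // N_max copiesE def_max.
  have ct : #|[set i : 'I_n | i < t]| = t.
    have w_inj : injective (widen_ord tn) by move=> i j /(congr1 val) /= /val_inj.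
    rewrite -[RHS](card_ord t) -(card_imset _ w_inj).
    apply: eq_card => i; rewrite inE; apply/idP/imsetP => [it|[j _ ->]]; last by rewrite /=.
    by exists (Ordinal it) => //; apply: val_inj.
  apply: (@bip_count_leq_bicliques _ _ [set i : 'I_n | i < t] (~: [set i : 'I_n | i < t])) => //.
  - by rewrite cardsCs setCK ct card_ord.
  - by apply/pred0P => i; rewrite /= in_setC andbN.
  - exact: adj_sym.
  move=> i j; rewrite !inE -leqNgt adj_graph_of_rel => it jt; rewrite it jt /= andbT.
  by apply: contraTneq it => ->; rewrite -leqNgt.
(* Used for both [F] and the triangle: neither is 2-colourable, so the bipartite graph [B] gives the
   lower bound in both cases. *)
have turanE (U : finType) (F' : sgraph U) : ~~ colorable F' 2 ->
    (forall G : sgraph 'I_n, graph_free F' G -> #|bicliques (adj G) al.+2 be.+2| <= M) ->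
    turan_ex n H F' = N.
  move=> nF' HF'; apply/eqP; rewrite eqn_leq; apply/andP; split.
    apply/bigmax_leqP => G /HF'; rewrite -copiesE -N_max leq_pmul2l //.
  apply: leq_trans NB _; apply: (leq_bigmax_cond (P := fun G => graph_free F' G)).
  exact: bipartite_free.
have K3 : turan_ex n H (complete_graph 3) = N.
  apply: turanE => [|G Gfree]; first exact: triangle_not_colorable.
  apply: triangle_free_max => [|u v]; first exact: card_ord.
  exact: triangle_free_nbh.
exists t; split; rewrite ?K3 //; apply: turanE.
  by rewrite colorable_chromatic hchi.
move=> G Gfree; have := Hn0 _ (adj G) (adj_sym G) (adj_irr G).
by rewrite card_ord => /(_ n0n); apply; apply: free_plus_free Gfree.
Qed.
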